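(* Let $(Q,\mathfrak n,k)$ be a local Noetherian ring, $R=Q/I$ a cyclic $Q$-algebra ($I$ proper), and $M$ a finitely generated $R$-module. Let $A$ and $G$ be minimal $Q$-free resolutions of $R$ and $M$, and assume $A$ is a dg-algebra, viewed as an $A_\infty$-algebra. If Avramov's obstruction $o(M)$ is non-zero, then for any $A_\infty$ $A$-module structure $(m_n^G)$ on $G$, the map $m_n^G$ contains a unit for some $n\ge3$, i.e. $m_n^G\otimes_Qk\ne0$ for some $n\ge3$.
   Context: Conventions: $\otimes=\otimes_Q$. Complexes are graded homologically. $M[1]_n=M_{n-1}$, $d_{M[1]}=-d_M$, and $s:M\to M[1]$ is the degree $1$ map $s(m)=m$. Signs: $(f\otimes g)(x\otimes y)=(-1)^{|g||x|}f(x)\otimes g(y)$. $A_0=Q$, $A_+=A_{\ge1}$. A free resolution is minimal if its differentials have image in $\mathfrak n$ times the target. Avramov's obstruction: $o(M)=\bigoplus_{q\ge1}o_q(M)$, where $$o_q(M)=\ker\left(\frac{\operatorname{Tor}^Q_q(M,k)}{(\operatorname{Tor}^Q_+(R,k)\cdot\operatorname{Tor}^Q_*(M,k))_q}\to\operatorname{Tor}^R_q(M,k)\right)$$ is the kernel of the map induced by change of rings. Here $\operatorname{Tor}_+^Q=\bigoplus_{i\ge1}\operatorname{Tor}_i^Q$, and the product $\operatorname{Tor}^Q_*(R,k)\otimes\operatorname{Tor}^Q_*(M,k)\to\operatorname{Tor}^Q_*(M,k)$ is the Cartan–Eilenberg product, induced by any chain map $A\otimes G\to G$ lifting $R\otimes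 M\to M$. A dg-algebra structure on $A$ means an associative multiplication $A\otimes A\to A$ that is a morphism of complexes with unit $1\in Q=A_0$. It is viewed as an $A_\infty$-algebra with $m_1$ the differential of the complex $A_+[1]$, $m_2(s(a)\otimes s(b))=(-1)^{|a|}s(ab)$ for $a,b\in A_+$, and $m_n=0$ for $n\ge3$. An $A_\infty$ $A$-module structure on $G$ is a sequence of degree $-1$ maps $m_n^G:A_+[1]^{\otimes n-1}\otimes G\to G$, $n\ge1$, such that $m_1^G=d^G$; $m_1^Gm_2^G+m_2^G(m_1\otimes1+1\otimes m_1^G)=d_1^A\otimes1$, where $d_1^A:A_1\to A_0=Q$ is viewed as a degree $-2$ map $A_+[1]\to Q$; and $\sum_{i=1}^n\sum_{j=0}^{n-i}m^G_{n-i+1}(1^{\otimes j}\otimes m_i\otimes1^{\otimes n-i-j})=0$ for all $n\ge3$, where $m_i$ means $m_i^G$ when $j=n-i$. *)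

(* Defs.v *)
From HB Require Import structures.
From mathcomp Require Import all_boot all_order all_algebra.
From mathcomp Require Import boolp.

Set Implicit Arguments.
Unset Strict Implicit.
Unset Printing Implicit Defensive.

Import GRing.Theory.
Local Open Scope ring_scope.
Local Open Scope quotient_scope.

Section Span.
Variables (S : comNzRingType) (V : lmodType S).
Implicit Types P : V -> Prop.

Definition span P (x : V) : Prop :=
  exists (n : nat) (c : 'I_n -> S) (v : 'I_n -> V),
    (forall i, P (v i)) /\ x = \sum_(i < n) c i *: v i.

Definition spanb P : {pred V} := fun x => `[< span P x >].

Lemma spanb_closed P : subsemimod_closed (spanb P).
Proof.
split; first split.
- apply/asboolP; exists 0%N, (fun=> 0), (fun=> 0).
  by split; [case | rewrite big_ord0].
- move=> _ _ /asboolP [n [c [v [Pv ->]]]] /asboolP [m [d [w [Pw ->]]]].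
  apply/asboolP; exists (n + m)%N.
  exists (fun i => match split i with inl j => c j | inr j => d j end).
  exists (fun i => match split i with inl j => v j | inr j => w j end).
  split=> [i|]; first by case: (split i).
  rewrite big_split_ord /=; congr (_ + _); apply: eq_bigr => i _.
    by rewrite (unsplitK (inl i)).
  by rewrite (unsplitK (inr i)).
- move=> a _ /asboolP [n [c [v [Pv ->]]]]; apply/asboolP.
  exists n, (fun i => a * c i), v; split=> //.
  by rewrite scaler_sumr; apply: eq_bigr => i _; rewrite scalerA.
Qed.

HB.instance Definition _ P :=
  GRing.isSubmodClosed.Build S V (spanb P) (spanb_closed P).

Lemma span_gen P x : P x -> span P x.
Proof.
move=> Px; exists 1%N, (fun=> 1), (fun=> x); split=> //.
by rewrite big_ord1 scale1r.
Qed.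

Lemma span_ker P (W : lmodType S) (f : {linear V -> W}) :
  (forall x, P x -> f x = 0) -> forall x, span P x -> f x = 0.
Proof.
move=> Pf x [n [c [v [Pv ->]]]]; rewrite linear_sum big1 // => i _.
by rewrite linearZ_LR /= Pf // scaler0.
Qed.

Definition quotmod P : Type := Quotient.quot (spanb P).

HB.instance Definition _ P := GRing.Zmodule.on (quotmod P).

Section Scale.
Variable P : V -> Prop.

Definition quot_pi (x : V) : quotmod P := \pi_(Quotient.quot (spanb P)) x.

Lemma quot_pi_surj (x : quotmod P) : exists y, x = quot_pi y.
Proof. by exists (repr x); rewrite /quot_pi reprK. Qed.

Lemma quot_pi_eq (x y : V) : quot_pi x = quot_pi y <-> span P (x - y).
Proof.
split=> [/eqP|h]; first by rewrite -Quotient.idealrBE => /asboolP.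
by apply/eqP; rewrite -Quotient.idealrBE; apply/asboolP.
Qed.

Fact quot_piB : zmod_morphism quot_pi.
Proof. by move=> x y; rewrite /quot_pi raddfB. Qed.

HB.instance Definition _ :=
  GRing.isZmodMorphism.Build V (quotmod P) quot_pi quot_piB.

Definition quot_scale (a : S) (x : quotmod P) : quotmod P :=
  quot_pi (a *: repr (x : Quotient.quot (spanb P))).

Fact quot_scaleE a x : quot_scale a (quot_pi x) = quot_pi (a *: x).
Proof.
apply/quot_pi_eq; rewrite -scalerBr; apply/asboolP.
apply: (@rpredZ _ _ (spanb P)); apply/asboolP/quot_pi_eq.
by rewrite /quot_pi reprK.
Qed.

Fact quot_scaleA a b x :
  quot_scale a (quot_scale b x) = quot_scale (a * b) x.
Proof. by have [y ->] := quot_pi_surj x; rewrite !quot_scaleE scalerA. Qed.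

Fact quot_scale1 : left_id 1 quot_scale.
Proof. by move=> x; have [y ->] := quot_pi_surj x; rewrite quot_scaleE scale1r. Qed.

Fact quot_scaleDr : right_distributive quot_scale +%R.
Proof.
move=> a x y; have [x' ->] := quot_pi_surj x; have [y' ->] := quot_pi_surj y.
by rewrite -raddfD !quot_scaleE scalerDr raddfD.
Qed.

Fact quot_scaleDl x : {morph quot_scale^~ x : a b / a + b}.
Proof.
by move=> a b; have [y ->] := quot_pi_surj x; rewrite !quot_scaleE scalerDl raddfD.
Qed.

HB.instance Definition _ := GRing.Zmodule_isLmodule.Build S (quotmod P)
  quot_scaleA quot_scale1 quot_scaleDr quot_scaleDl.

Fact quot_piZ : scalable quot_pi.
Proof. by move=> a x; rewrite -quot_scaleE. Qed.

HB.instance Definition _ :=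
  GRing.isScalable.Build S V (quotmod P) *:%R quot_pi quot_piZ.

Section Lift.
Variables (W : lmodType S) (f : {linear V -> W}).
Hypothesis Pf : forall x, P x -> f x = 0.

Definition quot_lift of (forall x, P x -> f x = 0) :=
  fun x : quotmod P => f (repr (x : Quotient.quot (spanb P))).

Lemma quot_liftE x : quot_lift Pf (quot_pi x) = f x.
Proof.
apply/eqP; rewrite -subr_eq0 /quot_lift -linearB; apply/eqP.
by apply: (span_ker Pf); apply/quot_pi_eq; rewrite /quot_pi reprK.
Qed.

Fact quot_lift_linear : linear (quot_lift Pf).
Proof.
move=> a x y; have [x' ->] := quot_pi_surj x; have [y' ->] := quot_pi_surj y.
by rewrite -linearP !quot_liftE linearP.
Qed.

HB.instance Definition _ :=
  GRing.isLinear.Build S (quotmod P) W *:%R (quot_lift Pf) quot_lift_linear.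
End Lift.
End Scale.
End Span.

Section Restriction.
Variables (S T : comNzRingType) (theta : {rmorphism S -> T}) (M : lmodType T).

Definition restr of {rmorphism S -> T} : Type := M.
Local Notation N := (restr theta).

HB.instance Definition _ := GRing.Zmodule.on N.

Definition restr_scale (a : S) (x : N) : N := theta a *: (x : M).

Fact restr_scaleA a b x : restr_scale a (restr_scale b x) = restr_scale (a * b) x.
Proof. by rewrite /restr_scale scalerA rmorphM. Qed.
Fact restr_scale1 : left_id 1 restr_scale.
Proof. by move=> x; rewrite /restr_scale rmorph1 scale1r. Qed.
Fact restr_scaleDr : right_distributive restr_scale +%R.
Proof. by move=> a x y; apply: scalerDr. Qed.
Fact restr_scaleDl x : {morph restr_scale^~ x : a b / a + b}.
Proof. by move=> a b; rewrite /restr_scale rmorphD scalerDl. Qed.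

HB.instance Definition _ := GRing.Zmodule_isLmodule.Build S N
  restr_scaleA restr_scale1 restr_scaleDr restr_scaleDl.
End Restriction.

(* Homologically graded complexes concentrated in degrees >= 0.  The
   differential in degree n lands in degree n.-1; in degree 0 it is zero. *)
Record complex (S : comNzRingType) := Complex {
  obj :> nat -> lmodType S;
  dif : forall n, {linear obj n -> obj n.-1};
  dif0 : forall x, dif 0 x = 0;
  difK : forall n x, dif n.-1 (dif n x) = 0
}.

Section Homology.
Variables (S : comNzRingType) (C : complex S) (q : nat).

Definition cycleb : {pred C q} := fun x => dif C q x == 0.

Fact cycleb_closed : subsemimod_closed cycleb.
Proof.
split; first split; rewrite /cycleb /in_mem /=.
- by rewrite linear0.
- by move=> x y; rewrite /in_mem /= linearD => /eqP-> /eqP->; rewrite addr0.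
- by move=> a x; rewrite /in_mem /= linearZ_LR => /eqP->; rewrite scaler0.
Qed.

HB.instance Definition _ := GRing.isSubmodClosed.Build S (C q) cycleb cycleb_closed.

Record cycles := Cycle { cycle_val :> C q; _ : cycleb cycle_val }.

HB.instance Definition _ := [isSub for cycle_val].
HB.instance Definition _ := [Choice of cycles by <:].
HB.instance Definition _ := [SubChoice_isSubLmodule of cycles by <:].

Definition is_boundary (z : cycles) : Prop :=
  exists y : C q.+1, dif C q.+1 y = val z.

Definition homology : lmodType S := quotmod is_boundary.

Definition hclass (z : cycles) : homology := quot_pi is_boundary z.
End Homology.

Record chain_map (S T : comNzRingType) (theta : {rmorphism S -> T})
    (C : complex S) (D : complex T) := ChainMap {
  cmap :> forall n, {linear C n -> restr (D n) theta};
  cmap_dif : forall n x, cmap n.-1 (dif C n x) = dif D n (cmap n x)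
}.

Section Residue.
Variables (S : comNzRingType) (k : fieldType) (rho : {rmorphism S -> k}).

Definition max_mult (V : lmodType S) (x : V) : Prop :=
  exists (a : S) (v : V), rho a = 0 /\ x = a *: v.

(* For rho : S ->> k surjective with kernel n, this is V (x)_S k = V / n V;
   [red V] below sends v to v (x) 1. *)
Definition redmod (V : lmodType S) : lmodType S := quotmod (@max_mult V).

Definition red (V : lmodType S) : {linear V -> redmod V} :=
  quot_pi (@max_mult V).

Section Map.
Variables (V W : lmodType S) (f : {linear V -> W}).

Fact red_map_subproof x : max_mult x -> (red W \o f) x = 0.
Proof.
move=> [a [v [ra ->]]]; rewrite /= linearZ_LR.
rewrite -[RHS](linear0 (red W)); apply/quot_pi_eq; rewrite subr0.
by apply: span_gen; exists a, (f v).
Qed.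

Definition red_map : {linear redmod V -> redmod W} :=
  quot_lift red_map_subproof.

Fact red_mapE x : red_map (red V x) = red W (f x).
Proof. exact: quot_liftE. Qed.
End Map.

Section Cpx.
Variable C : complex S.

Fact red_dif0 (x : redmod (C 0%N)) : red_map (dif C 0) x = 0.
Proof.
by have [y ->] := quot_pi_surj x; rewrite red_mapE dif0 linear0.
Qed.

Fact red_difK n (x : redmod (C n)) :
  red_map (dif C n.-1) (red_map (dif C n) x) = 0.
Proof.
by have [y ->] := quot_pi_surj x; rewrite !red_mapE difK linear0.
Qed.

Definition redC : complex S := Complex red_dif0 red_difK.
End Cpx.
End Residue.

Section ChainHomology.
Variables (S T : comNzRingType) (theta : {rmorphism S -> T}).
Variables (C : complex S) (D : complex T).

Section Hom.
Variables (f : chain_map theta C D) (q : nat).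

Fact cycle_map_subproof (z : cycles C q) :
  cycleb (C := D) (q := q) (f q (val z)).
Proof.
case: z => x /= /eqP zx; apply/eqP.
by rewrite -cmap_dif zx linear0.
Qed.

Definition cycle_map (z : cycles C q) : cycles D q := Cycle (cycle_map_subproof z).

Definition hmap_pre (z : cycles C q) : restr (homology D q) theta :=
  hclass (cycle_map z).

Fact hmap_pre_linear : linear hmap_pre.
Proof.
move=> a x y; rewrite /hmap_pre /hclass.
have -> : cycle_map (a *: x + y) = theta a *: cycle_map x + cycle_map y.
  by apply: val_inj; rewrite /= linearP.
by rewrite linearP.
Qed.

HB.instance Definition _ := GRing.isLinear.Build S (cycles C q)
  (restr (homology D q) theta) *:%R hmap_pre hmap_pre_linear.

Fact hmap_subproof z : is_boundary z -> hmap_pre z = 0.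
Proof.
move=> [y dy]; rewrite /hmap_pre /hclass -(linear0 (quot_pi (@is_boundary _ D q))).
apply/quot_pi_eq; rewrite subr0; apply: span_gen; exists (f q.+1 y).
by rewrite -(cmap_dif f (n := q.+1)) dy.
Qed.

Definition hmap : {linear homology C q -> restr (homology D q) theta} :=
  quot_lift hmap_subproof.

Fact hmapE z : hmap (hclass z) = hclass (cycle_map z).
Proof. exact: quot_liftE. Qed.
End Hom.

Section Red.
Variables (k : fieldType) (kappa : {rmorphism T -> k}) (f : chain_map theta C D).
Local Notation rho := (kappa \o theta : {rmorphism S -> k}).

Definition red_cmap_pre n (x : C n) : restr (redmod kappa (D n)) theta :=
  red kappa (D n) (f n x).

Fact red_cmap_pre_linear n : linear (@red_cmap_pre n).
Proof. by move=> a x y; rewrite /red_cmap_pre linearP /= linearP. Qed.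

HB.instance Definition _ n := GRing.isLinear.Build S (C n)
  (restr (redmod kappa (D n)) theta) *:%R (@red_cmap_pre n)
  (@red_cmap_pre_linear n).

Fact red_cmap_subproof n x : max_mult rho x -> @red_cmap_pre n x = 0.
Proof.
move=> [a [v [ra ->]]]; rewrite /red_cmap_pre linearZ_LR.
rewrite -[RHS](linear0 (red kappa (D n))); apply/quot_pi_eq; rewrite subr0.
by apply: span_gen; exists (theta a), (f n v).
Qed.

Definition red_cmap_fun n :
    {linear redC rho C n -> restr (redC kappa D n) theta} :=
  quot_lift (@red_cmap_subproof n).

Fact red_cmapE n (x : C n) :
  red_cmap_fun n (red rho (C n) x) = red kappa (D n) (f n x).
Proof. exact: quot_liftE. Qed.

Fact red_cmap_dif n (x : redC rho C n) :
  red_cmap_fun n.-1 (dif (redC rho C) n x)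
  = dif (redC kappa D) n (red_cmap_fun n x).
Proof.
have [y ->] := quot_pi_surj x.
rewrite -[quot_pi _ y]/(red rho (C n) y) red_cmapE.
have -> : dif (redC rho C) n (red rho (C n) y) = red rho (C n.-1) (dif C n y).
  exact: red_mapE.
by rewrite red_cmapE cmap_dif; symmetry; apply: (red_mapE kappa (dif D n)).
Qed.

(* The map C (x)_S k -> D (x)_T k induced by C -> D. *)
Definition red_cmap : chain_map theta (redC rho C) (redC kappa D) :=
  ChainMap red_cmap_dif.
End Red.
End ChainHomology.

Definition is_submodule (S : comNzRingType) (V : lmodType S) (P : V -> Prop) :=
  P 0 /\ forall (a : S) x y, P x -> P y -> P (a *: x + y).

Definition fin_gen (S : comNzRingType) (V : lmodType S) : Prop :=
  exists s : seq V, forall x, span (fun y => y \in s) x.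

Definition noetherian (S : comNzRingType) : Prop :=
  forall J : S^o -> Prop, is_submodule J ->
  exists s : seq S^o, forall x, J x <-> span (fun y => y \in s) x.

Definition local_ring (S : comNzRingType) (n : S -> Prop) : Prop :=
  is_submodule (n : S^o -> Prop) /\ forall x, n x <-> ~ exists y, x * y = 1.

Definition free_module (S : comNzRingType) (V : lmodType S) : Prop :=
  exists (B : choiceType) (b : B -> V),
    (forall x, span (fun y => exists e, y = b e) x) /\
    (forall (s : seq B) (c : B -> S), uniq s ->
       \sum_(e <- s) c e *: b e = 0 -> forall e, e \in s -> c e = 0).

Record free_resolution (S : comNzRingType) (N : lmodType S) := FreeResolution {
  res_cpx :> complex S;
  aug : {linear res_cpx 0%N -> N};
  res_free : forall n, free_module (res_cpx n);
  aug_surj : forall y, exists x, aug x = y;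
  res_exact0 : forall x, aug x = 0 <-> exists y, dif res_cpx 1 y = x;
  res_exact : forall n (x : res_cpx n.+1),
    dif res_cpx n.+1 x = 0 -> exists y, dif res_cpx n.+2 y = x
}.

Definition minimal (S : comNzRingType) (n : S -> Prop) (C : complex S) : Prop :=
  forall i (x : C i.+1),
    span (fun y => exists a v, n a /\ y = a *: v) (dif C i.+1 x).

(* A morphism of complexes X (x) Y -> Z, given by its bilinear components
   X_i x Y_j -> Z_n, which vanish unless n = i + j. *)
Record tensor_map (S : comNzRingType) (X Y Z : complex S) := TensorMap {
  tmap :> forall i j n, X i -> Y j -> Z n;
  tmap_linl : forall i j n (y : Y j), linear (fun x : X i => tmap n x y);
  tmap_linr : forall i j n (x : X i), linear (fun y : Y j => tmap n x y);
  tmap_deg : forall i j n (x : X i) (y : Y j), n <> (i + j)%N -> tmap n x y = 0;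
  tmap_dif : forall i j (x : X i) (y : Y j),
    dif Z (i + j) (tmap (i + j) x y) =
      tmap (i + j).-1 (dif X i x) y + (-1) ^+ i *: tmap (i + j).-1 x (dif Y j y)
}.

Section DGA.
Variables (Q R : comNzRingType) (pi : {rmorphism Q -> R}).

(* A dg-algebra structure on a resolution A of R; [dg_coord] is the
   identification A_0 = Q, under which the augmentation A_0 -> R is pi. *)
Record dg_algebra (A : free_resolution (restr R^o pi)) := DGAlgebra {
  dg_mul :> tensor_map A A A;
  dg_one : A 0%N;
  dg_coord : {linear A 0%N -> Q^o};
  dg_coord1 : dg_coord dg_one = 1;
  dg_coordK : forall x, dg_coord x *: dg_one = x;
  dg_aug1 : aug A dg_one = (1 : R);
  dg_mul1 : forall i (x : A i), dg_mul 0%N i i dg_one x = x;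
  dg_mulr1 : forall i (x : A i), dg_mul i 0%N i x dg_one = x;
  dg_mulA : forall i j l (x : A i) (y : A j) (z : A l),
    dg_mul _ _ (i + j + l)%N (dg_mul _ _ (i + j)%N x y) z =
    dg_mul _ _ (i + j + l)%N x (dg_mul _ _ (j + l)%N y z)
}.

Section Ainf.
Variables (A : free_resolution (restr R^o pi)) (mul : dg_algebra A).

(* Homogeneous elements of A_+[1]: [Tagged _ (a : A i.+1)] is s(a), of degree
   i + 2. *)
Definition shifted : Type := {i : nat & A i.+1}.

Definition sus i (a : A i.+1) : shifted := Tagged (fun i => A i.+1) a.

Definition sdeg (w : seq shifted) : nat := \sum_(a <- w) (tag a).+2.

(* The differential of A_+[1], which vanishes on s(A_1). *)
Definition ainf_m1 (a : shifted) : shifted :=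
  match tag a as i return A i.+1 -> shifted with
  | 0%N => fun=> sus (0 : A 1%N)
  | i.+1 => fun x => @sus i (- dif A i.+2 x)
  end (tagged a).

Definition ainf_m2 (a b : shifted) : shifted :=
  @sus (tag a + (tag b).+1)%N
    ((-1) ^+ (tag a).+1 *: mul _ _ _ (tagged a) (tagged b)).

Definition ainf_m (w : seq shifted) : shifted :=
  match w with
  | [:: a] => ainf_m1 a
  | [:: a; b] => ainf_m2 a b
  | _ => sus (0 : A 1%N)
  end.

(* The map d_1 (x) 1 : A_+[1] (x) G -> G of degree -2, with d_1 : A_1 -> A_0 = Q. *)
Definition d1_tensor (G : complex Q) (a : shifted) j (x : G j) : G (tag a + j)%N :=
  match tag a as i return A i.+1 -> G (i + j)%N with
  | 0%N => fun a1 => dg_coord mul (dif A 1%N a1) *: x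
  | _.+1 => fun=> 0
  end (tagged a).

(* [ainf_map w j n] is the component G_j -> G_n of the value of m_(size w).+1
   on the word w of homogeneous elements of A_+[1].  In [ainf_rel] the sum runs
   over decompositions 1^t (x) m_i (x) 1^(N-i-t), N = size w + 1; the map m_i,
   of degree -1, passes the first t letters, which gives the Koszul sign. *)
Record ainf_module (G : complex Q) := AinfModule {
  ainf_map :> forall (w : seq shifted) (j n : nat), {linear G j -> G n};
  ainf_multilinear : forall u v i (c : Q) (a b : A i.+1) j n (x : G j),
    ainf_map (u ++ sus (c *: a + b) :: v) j n x =
    c *: ainf_map (u ++ sus a :: v) j n x + ainf_map (u ++ sus b :: v) j n x;
  ainf_degree : forall w j n (x : G j),
    n.+1 <> (sdeg w + j)%N -> ainf_map w j n x = 0;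
  ainf_map1 : forall j (x : G j), ainf_map [::] j j.-1 x = dif G j x;
  ainf_rel2 : forall (a : shifted) j (x : G j),
    let n := (tag a + j)%N in
    ainf_map [::] n.+1 n (ainf_map [:: a] j n.+1 x)
    + (ainf_map [:: ainf_m [:: a]] j n x
       + (-1) ^+ (tag a).+2 *: ainf_map [:: a] j.-1 n (ainf_map [::] j j.-1 x))
    = d1_tensor a x;
  ainf_rel : forall (w : seq shifted) j (x : G j), (2 <= size w)%N ->
    let N := (size w).+1 in
    let n := (sdeg w + j).-2 in
    \sum_(1 <= i < N.+1) \sum_(0 <= t < (N - i).+1)
      (-1) ^+ sdeg (take t w) *:
      (if t == (N - i)%N
       then let l := (sdeg (drop t w) + j).-1 in
            ainf_map (take t w) l n (ainf_map (drop t w) j l x)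
       else ainf_map
              (take t w ++ ainf_m (take i (drop t w)) :: drop (t + i) w) j n x)
    = 0
}.
End Ainf.
End DGA.

Section Obstruction.
Variables (Q R : comNzRingType) (pi : {rmorphism Q -> R}).
Variables (k : fieldType) (kappa : {rmorphism R -> k}) (M : lmodType R).
Local Notation rho := (kappa \o pi : {rmorphism Q -> k}).

Definition Tor (S : comNzRingType) (sigma : {rmorphism S -> k}) (N : lmodType S)
    (C : free_resolution N) (q : nat) : lmodType S :=
  homology (redC sigma C) q.

(* x (x) 1 is a cycle of C (x)_S k with homology class t. *)
Definition represents (S : comNzRingType) (sigma : {rmorphism S -> k})
    (N : lmodType S) (C : free_resolution N) q (x : C q) (t : Tor sigma C q) :=
  exists z : cycles (redC sigma C) q,
    val z = red sigma (C q) x /\ t = hclass z.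

Variables (A : free_resolution (restr R^o pi)) (G : free_resolution (restr M pi)).
Variable F : free_resolution M.

Definition lifts_action (mu : tensor_map A G G) : Prop :=
  forall (a : A 0%N) (x : G 0%N),
    aug G (mu _ _ 0%N a x) = (aug A a : R) *: (aug G x : M).

Definition lifts_id (phi : chain_map pi G F) : Prop :=
  forall x : G 0%N, aug F (phi 0%N x) = (aug G x : M).

(* t is the Cartan-Eilenberg product of t1 and t2, computed on cycles with mu. *)
Definition tor_product (mu : tensor_map A G G) i j n
    (t1 : Tor rho A i) (t2 : Tor rho G j) (t : Tor rho G n) : Prop :=
  exists (a : A i) (x : G j),
    [/\ represents a t1, represents x t2 & represents (mu _ _ n a x) t].

Definition tor_decomposable (mu : tensor_map A G G) q (t : Tor rho G q) : Prop :=
  exists i j (t1 : Tor rho A i) (t2 : Tor rho G j),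
    [/\ (0 < i)%N, (i + j = q)%N & tor_product mu t1 t2 t].

(* Tor^Q_q(M,k) / (Tor^Q_+(R,k) . Tor^Q_*(M,k))_q *)
Definition tor_indec (mu : tensor_map A G G) q : lmodType Q :=
  quotmod (@tor_decomposable mu q).

Definition tor_change (phi : chain_map pi G F) q :
    {linear Tor rho G q -> restr (Tor kappa F q) pi} :=
  hmap (red_cmap kappa phi) q.

(* o_q(M), the kernel of the map tor_indec mu q -> Tor^R_q(M,k) induced by
   tor_change phi q. *)
Definition obstruction (mu : tensor_map A G G) (phi : chain_map pi G F) q
    (c : tor_indec mu q) : Prop :=
  exists t, c = quot_pi (@tor_decomposable mu q) t /\ tor_change phi q t = 0.

Definition obstruction_nonzero (mu : tensor_map A G G) (phi : chain_map pi G F) :=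
  exists q (c : tor_indec mu q), [/\ (1 <= q)%N, obstruction phi c & c <> 0].
End Obstruction.

(* m_n (x)_Q k is nonzero.  Elements s(a_1) (x) ... (x) s(a_(n-1)) (x) x (x) 1 with
   homogeneous a_i and x generate the source of m_n (x)_Q k. *)
Definition ainf_contains_unit (Q R : comNzRingType) (pi : {rmorphism Q -> R})
    (k : fieldType) (rho : {rmorphism Q -> k})
    (A : free_resolution (restr R^o pi)) (mul : dg_algebra A) (G : complex Q)
    (m : ainf_module mul G) (n : nat) : Prop :=
  exists (w : seq (shifted A)) (j l : nat) (x : G j),
    (size w).+1 = n /\ red rho (G l) (m w j l x) <> 0.

(* Main.v *)
(* Suppose that m_n (x) k = 0 for all n >= 3.  On the bar module B = T(A_+[1]) (x) G
   the operations of A and G sum up to an operator D whose square is the curvature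
   [a_1|...|a_p]x |-> d_1(a_1) [a_2|...|a_p]x, which vanishes over R.  Hence
   R (x) B is a complex; killing the first letters one degree at a time, using that
   A is acyclic and the rest of each word runs over a free module, shows that it
   resolves M.  A lift F -> R (x) B of the identity of M, composed with G -> F, is
   thus homotopic to the inclusion G -> R (x) B.

   Sending G_q to the indecomposables of Tor^Q(M,k) and the other words to 0
   annihilates the image of D: modulo the maximal ideal the words of G only receive
   m_2(A_+, G) under D, and m_2 agrees there with the Cartan-Eilenberg product.  So
   the map from G_q to the indecomposables factors through Tor^R_q(M,k), that is,
   o_q(M) = 0. *)

Require Import Defs.
From HB Require Import structures.
From mathcomp Require Import all_boot all_order all_algebra.
From mathcomp Require Import boolp.
From mathcomp Require Import monalg ring.

Set Implicit Arguments.
Unset Strict Implicit.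
Unset Printing Implicit Defensive.

Import GRing.Theory.
Local Open Scope ring_scope.
Local Notation span := Defs.span.

(** * Linear algebra over free modules *)

(** The letters come from A_+ only, so m_1 forgets the component d_1 : A_1 -> A_0 = Q. This missing
    term is the source of the curvature, and since d_1 has image ker pi, the curvature maps onto ker
    pi times the bar module. The obstacle to exactness over R is that R (x) A is in general not
    acyclic, so leading letters cannot be killed there. The argument runs over Q instead: an element
    whose differential vanishes modulo ker pi is first corrected by some D u to a true D-cycle. Its
    curvature D^2 is then zero, which says that its leading coordinates in A_1 are cycles, and
    exactness of A over Q applies. Minimality removes both homotopies at the end: the
    indecomposables are killed by the maximal ideal, and the differentials of A and G take values in
    multiples of it. All degrees share one module with projections [homog], which avoids casts
    between degrees that are equal but computed differently. *)

Section Linear.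
Variable S : comNzRingType.
Implicit Types V W U X : lmodType S.

Fact mklin_subproof V W (f : V -> W) :
  linear f -> {g : {linear V -> W} | forall x, g x = f x}.
Proof.
move=> f_lin.
pose g : {linear V -> W} := HB.pack f (GRing.isLinear.Build S V W *:%R f f_lin).
by exists g.
Qed.

(** Opaque through its subproof, so a bundled map never unfolds; it computes by [mklinE] only. *)
Definition mklin V W (f : V -> W) (f_lin : linear f) : {linear V -> W} :=
  sval (mklin_subproof f_lin).

Lemma mklinE V W (f : V -> W) (f_lin : linear f) x : mklin f_lin x = f x.
Proof. by rewrite /mklin; case: mklin_subproof. Qed.

Lemma span_ind V (P K : V -> Prop) :
  K 0 -> (forall c x y, P x -> K y -> K (c *: x + y)) ->
  forall x, span P x -> K x.
Proof.
move=> K0 KD _ [n [c [v [Pv ->]]]].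
elim: n c v Pv => [|n IHn] c v Pv; first by rewrite big_ord0.
by rewrite big_ord_recl; apply: KD => //; apply: IHn.
Qed.

Lemma span0 V (P : V -> Prop) : span P 0.
Proof. by exists 0%N, (fun=> 0), (fun=> 0); split; [case | rewrite big_ord0]. Qed.

Lemma spanP V (P : V -> Prop) c x y : span P x -> span P y -> span P (c *: x + y).
Proof.
move=> Px Py; apply/asboolP; apply: (@rpredD _ (spanb P)); last exact/asboolP.
by apply: (@rpredZ _ _ (spanb P)); apply/asboolP.
Qed.

Lemma span_linear V W (f : {linear V -> W}) (P : V -> Prop) (K : W -> Prop) :
  (forall x, P x -> span K (f x)) -> forall x, span P x -> span K (f x).
Proof.
move=> PK; apply: span_ind => [|c x y Px Ky]; first by rewrite linear0; apply: span0.
by rewrite linearP; apply: spanP => //; apply: PK.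
Qed.

Lemma span_seq V (B : Type) (b : B -> V) x :
  span (fun y => exists e, y = b e) x ->
  exists s : seq (S * B), x = \sum_(p <- s) p.1 *: b p.2.
Proof.
move: x; apply: span_ind => [|c _ y [e ->] [s ->]]; first by exists [::]; rewrite big_nil.
by exists ((c, e) :: s); rewrite big_cons.
Qed.

Lemma sum_collect V (B : choiceType) (u : B -> V) (s : seq (S * B)) :
  \sum_(p <- s) p.1 *: u p.2 =
  \sum_(e <- undup (map snd s)) (\sum_(p <- s | p.2 == e) p.1) *: u e.
Proof.
rewrite [RHS](eq_bigr (fun e => \sum_(p <- s | p.2 == e) p.1 *: u e)); last by move=> e _; rewrite scaler_suml.
rewrite (exchange_big_dep predT) //= [LHS]big_seq [RHS]big_seq; apply: eq_bigr => p ps.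
rewrite (eq_bigr (fun=> p.1 *: u p.2)); last by move=> e /eqP<-.
rewrite -big_filter (eq_filter (a2 := pred1 p.2)); last by move=> e; rewrite /= eq_sym.
rewrite filter_pred1_uniq ?undup_uniq ?mem_undup ?map_f //.
by rewrite big_seq1.
Qed.

Section Extension.
Variables (V W : lmodType S) (B : choiceType) (b : B -> V) (u : B -> W).
Hypothesis b_span : forall x, span (fun y => exists e, y = b e) x.
Hypothesis b_free : forall (s : seq B) (c : B -> S), uniq s ->
  \sum_(e <- s) c e *: b e = 0 -> forall e, e \in s -> c e = 0.

Lemma basis_ext : exists f : {linear V -> W}, forall e, f (b e) = u e.
Proof.
pose F x y := exists s : seq (S * B),
  x = \sum_(p <- s) p.1 *: b p.2 /\ y = \sum_(p <- s) p.1 *: u p.2.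
have FP c x y x' y' : F x x' -> F y y' -> F (c *: x + y) (c *: x' + y').
  move=> [s [-> ->]] [t [-> ->]]; exists ([seq (c * p.1, p.2) | p <- s] ++ t).
  by rewrite !big_cat !big_map !scaler_sumr; split; congr (_ + _);
     apply: eq_bigr => p _; rewrite scalerA.
(* Freeness makes the relation [F] single-valued: once repeated indices are collected, a combination
   equal to 0 has zero coefficients. *)
have F0 y : F 0 y -> y = 0.
  move=> [s [/esym]]; rewrite sum_collect => /(b_free (undup_uniq _)) s0 ->.
  by rewrite sum_collect big_seq big1 // => e /s0 ->; rewrite scale0r.
have /choice [f fF] x : exists y, F x y.
  by have [s xs] := span_seq (b_span x); exists (\sum_(p <- s) p.1 *: u p.2), s.
have f_uniq x y : F x y -> f x = y.
  move=> /(FP (-1) _ _ _ _ (fF x)); rewrite !scaleN1r addNr => /F0/eqP.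
  by rewrite addrC subr_eq0 => /eqP.
have f_lin : linear f by move=> c x y; apply: f_uniq; apply: FP.
exists (mklin f_lin) => e; rewrite mklinE; apply: f_uniq; exists [:: (1, e)].
by rewrite !big_seq1 !scale1r.
Qed.
End Extension.

(** Independence is recorded by dual functionals, because the coordinates of a word in the bar
    module are products of those of its letters. *)
Record basis V := Basis {
  bas_index : choiceType;
  bas_elt : bas_index -> V;
  bas_coord : bas_index -> {linear V -> S^o};
  bas_span : forall x, span (fun y => exists e, y = bas_elt e) x;
  bas_dual : forall e e', bas_coord e (bas_elt e') = (e == e')%:R
}.

Lemma free_basis V : free_module V -> basis V.
Proof.
move=> /cid [B /cid [b [b_span b_free]]].
have co_ex e := basis_ext (fun e' => (e == e')%:R : S^o) b_span b_free.
have [co coE] := choice co_ex.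
by exists B b co.
Qed.

Lemma free_lift V U W (f : {linear V -> W}) (p : {linear U -> W}) :
  free_module V -> (forall x, exists y, p y = f x) ->
  exists g : {linear V -> U}, forall x, p (g x) = f x.
Proof.
move=> [B [b [b_span b_free]]] fp.
have /choice [u pu] e := fp (b e).
have [g gb] := basis_ext u b_span b_free.
exists g => x; move: x (b_span x); apply: span_ind => [|c _ y [e ->] yE].
  by rewrite !linear0.
by rewrite !linearP gb pu yE.
Qed.

Definition bilin V W U (f : V -> W -> U) :=
  (forall y, linear (f^~ y)) /\ (forall x, linear (f x)).

(** Stands in for lifting out of V (x) W, which is never formed: a lift in the second variable is
    chosen for each basis element of V, then extended linearly in the first. *)
Lemma free_lift2 V W U X (f : V -> W -> X) (p : {linear U -> X}) :
  free_module V -> free_module W -> bilin f ->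
  (forall x y, exists z, p z = f x y) ->
  exists g : V -> W -> U, bilin g /\ forall x y, p (g x y) = f x y.
Proof.
move=> [B [b [b_span b_free]]] Wfree [fl fr] fp.
have /choice [g pg] e : exists g : {linear W -> U}, forall y, p (g y) = f (b e) y.
  have [y|g pg] := free_lift (f := mklin (fr (b e))) (p := p) Wfree.
    by rewrite mklinE; apply: fp.
  by exists g => y; rewrite pg mklinE.
have /choice [h hb] y := basis_ext (fun e => g e y) b_span b_free.
exists (fun x y => h y x); split; first split.
- by move=> y c x x'; rewrite linearP.
- move=> x c y y'.
  move: x (b_span x); apply: span_ind => [|d _ x' [e ->] IHx].
    by rewrite !linear0 addr0.
  by rewrite !linearP IHx !hb linearP !scalerDr !scalerA addrACA [d * c]mulrC.
move=> x y; move: x (b_span x); apply: span_ind => [|c _ x' [e ->] IHx].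
  by rewrite !linear0 -(mklinE (fl y)) linear0.
rewrite linearP hb linearP IHx pg.
by rewrite -!(mklinE (fl y)) linearP.
Qed.
End Linear.

(** * Formal linear combinations, the generators for a presentation of the bar module *)

Section FreeModule.
Variables (S : comNzRingType) (W : choiceType).

Definition formal : lmodType S := malg W S.
Definition word_elt (w : W) : formal := mkmalgU w 1.

Lemma word_elt_span x : span (fun y => exists w, y = word_elt w) x.
Proof.
rewrite [x]monalgE.
apply: (big_ind (span _)) => [|y z sy sz|w _].
- exact: span0.
- by rewrite -[y]scale1r; apply: spanP.
- have -> : mkmalgU w (mcoeff w x) = mcoeff w x *: word_elt w + 0.
    rewrite addr0; apply/malgP => v.
    by rewrite mcoeffZ !mcoeffU mulrnAr mulr1.
  by apply: spanP; [apply: span_gen; exists w | apply: span0].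
Qed.

Lemma word_elt_free (s : seq W) (c : W -> S) : uniq s ->
  \sum_(w <- s) c w *: word_elt w = 0 -> forall w, w \in s -> c w = 0.
Proof.
move=> s_uniq s0 w ws; have := congr1 (mcoeff w) s0.
rewrite raddf0 raddf_sum (bigD1_seq w) //= big1 => [|v /negPf vw].
  by rewrite addr0 mcoeffZ mcoeffU eqxx mulr1.
by rewrite mcoeffZ mcoeffU vw mulr0.
Qed.

Definition formal_ext (V : lmodType S) (u : W -> V) : {linear formal -> V} :=
  projT1 (cid (basis_ext u word_elt_span word_elt_free)).

Lemma formal_extE (V : lmodType S) (u : W -> V) w : formal_ext u (word_elt w) = u w.
Proof. by rewrite /formal_ext; case: cid. Qed.
End FreeModule.

(** * The bar module *)

Section Bar.
Variables (Q R : comNzRingType) (pi : {rmorphism Q -> R}).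
Variables (A : free_resolution (restr R^o pi)) (G : complex Q).

Definition letter : choiceType := {i : nat & A i.+1}.
Definition last_letter : choiceType := {j : nat & G j}.
Definition last_of j (x : G j) : last_letter := Tagged (fun j => G j) x.
Implicit Types (a b : letter) (u v w : seq letter) (x y : last_letter).

(** Linearity relates letters of equal degree only, so the universal target is the direct sum over
    all sequences of degrees. *)
Definition multilinear (V : lmodType Q) (f : seq letter -> last_letter -> V) :=
  (forall u v i c (a b : A i.+1) x,
     f (u ++ sus (c *: a + b) :: v) x =
     c *: f (u ++ sus a :: v) x + f (u ++ sus b :: v) x) /\
  (forall w j c (x y : G j),
     f w (last_of (c *: x + y)) = c *: f w (last_of x) + f w (last_of y)).

Record tensor_bar := TensorBar {
  tb_mod : lmodType Q;
  tb_word : seq letter -> last_letter -> tb_mod;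
  tb_multilinear : multilinear tb_word;
  tb_lift : forall (V : lmodType Q) f, @multilinear V f -> {linear tb_mod -> V};
  tb_liftE : forall (V : lmodType Q) f (f_lin : @multilinear V f) w x,
    tb_lift f_lin (tb_word w x) = f w x;
  tb_ind : forall K : tb_mod -> Prop,
    K 0 -> (forall c t z, K t -> K z -> K (c *: t + z)) ->
    (forall w x, K (tb_word w x)) -> forall z, K z
}.

Section Construction.
Definition formal_word w x : formal Q (seq letter * last_letter)%type :=
  word_elt Q (w, x).

Definition bar_rel (r : formal Q (seq letter * last_letter)%type) : Prop :=
  (exists u v i c (a b : A i.+1) x,
     r = formal_word (u ++ sus (c *: a + b) :: v) x
         - (c *: formal_word (u ++ sus a :: v) x + formal_word (u ++ sus b :: v) x))
  \/ (exists w j c (x y : G j),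
     r = formal_word w (last_of (c *: x + y))
         - (c *: formal_word w (last_of x) + formal_word w (last_of y))).

Fact quot_word_multilinear :
  multilinear (fun w x => quot_pi bar_rel (formal_word w x)).
Proof.
split=> [u v i c a b x|w j c x y];
  rewrite -linearP; apply/(quot_pi_eq bar_rel); apply: span_gen.
- by apply: or_introl; exists u, v, i, c, a, b, x.
- by apply: or_intror; exists w, j, c, x, y.
Qed.

Fact quot_word_ind (K : quotmod bar_rel -> Prop) :
  K 0 -> (forall c t z, K t -> K z -> K (c *: t + z)) ->
  (forall w x, K (quot_pi bar_rel (formal_word w x))) -> forall z, K z.
Proof.
move=> K0 KD Kw z; have [t ->] := quot_pi_surj z.
move: t (word_elt_span t); apply: span_ind; first by rewrite linear0; apply: K0.
by move=> c _ t [[w x] ->] Kt; rewrite linearP; apply: KD => //; apply: Kw.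
Qed.

Fact bar_rel_eq0 (V : lmodType Q) (f : seq letter -> last_letter -> V) :
  multilinear f ->
  forall r, bar_rel r -> formal_ext (fun p => f p.1 p.2) r = 0.
Proof.
case=> f1 f2 r [[u [v [i [c [a [b [x ->]]]]]]]|[w [j [c [x [y ->]]]]]];
  rewrite linearB linearP !formal_extE /=.
- by rewrite f1 subrr.
- by rewrite f2 subrr.
Qed.

Fact tensor_bar_exists : tensor_bar.
Proof.
apply: (@TensorBar (quotmod bar_rel) _ quot_word_multilinear
  (fun V f f_lin => quot_lift (bar_rel_eq0 f_lin))); last exact: quot_word_ind.
by move=> V f f_lin w x /=; rewrite quot_liftE formal_extE.
Qed.
End Construction.

(* T(A_+[1]) (x) G, with all degrees in one module; [tensor_bar_exists] is opaque
   so that conversion never unfolds the quotient. *)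
Definition bar : lmodType Q := tb_mod tensor_bar_exists.

Definition bar_word w x : bar := tb_word tensor_bar_exists w x.

Lemma bar_word_multilinear : multilinear bar_word.
Proof. exact: tb_multilinear. Qed.

Lemma bar_ind (K : bar -> Prop) :
  K 0 -> (forall c t z, K t -> K z -> K (c *: t + z)) ->
  (forall w x, K (bar_word w x)) -> forall z, K z.
Proof. exact: tb_ind. Qed.

Definition bar_lift (V : lmodType Q) (f : seq letter -> last_letter -> V)
  (f_lin : multilinear f) : {linear bar -> V} := tb_lift tensor_bar_exists f_lin.

Lemma bar_liftE (V : lmodType Q) (f : seq letter -> last_letter -> V)
  (f_lin : multilinear f) w x : bar_lift f_lin (bar_word w x) = f w x.
Proof. exact: tb_liftE. Qed.

Lemma bar_ext (V : lmodType Q) (f g : {linear bar -> V}) :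
  (forall w x, f (bar_word w x) = g (bar_word w x)) -> forall z, f z = g z.
Proof.
move=> fg; apply: bar_ind => // [|c t z ft fz]; first by rewrite !linear0.
by rewrite !linearP ft fz.
Qed.

Definition letter_linear (V : lmodType Q) (g : letter -> V) :=
  forall i c (a b : A i.+1), g (sus (c *: a + b)) = c *: g (sus a) + g (sus b).

Lemma letter_linear0 (V : lmodType Q) (g : letter -> V) i :
  letter_linear g -> g (@sus _ _ _ A i 0) = 0.
Proof.
move=> g_lin; have := g_lin i (-1) 0 0; rewrite scaler0 addr0 => ->.
by rewrite scaleN1r addNr.
Qed.

Lemma letter_linearZ (V : lmodType Q) (g : letter -> V) i c (a : A i.+1) :
  letter_linear g -> g (sus (c *: a)) = c *: g (sus a).
Proof.
by move=> g_lin; rewrite -[c *: a]addr0 g_lin letter_linear0 // addr0.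
Qed.

Lemma bar_word_cons w x : letter_linear (fun a => bar_word (a :: w) x).
Proof. by move=> i c a b; apply: (bar_word_multilinear.1 [::]). Qed.

Lemma multilinear_cons (V : lmodType Q) (f : seq letter -> last_letter -> V) :
  (forall w x, letter_linear (fun a => f (a :: w) x)) ->
  (forall a, multilinear (fun w x => f (a :: w) x)) ->
  (forall j c (x y : G j), f [::] (last_of (c *: x + y)) =
    c *: f [::] (last_of x) + f [::] (last_of y)) ->
  multilinear f.
Proof.
move=> f1 f2 f3; split=> [[|a' u] v i c a b x|[|a w] j c x y].
- exact: f1.
- exact: (f2 a').1.
- exact: f3.
- exact: (f2 a).2.
Qed.

Lemma multilinear_tail (V : lmodType Q) (f : seq letter -> last_letter -> V) a :
  multilinear f -> multilinear (fun w x => f (a :: w) x).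
Proof. by case=> f1 f2; split=> *; [apply: (f1 (a :: _)) | apply: f2]. Qed.

Lemma multilinear_head (V : lmodType Q) (f : seq letter -> last_letter -> V) w x :
  multilinear f -> letter_linear (fun a => f (a :: w) x).
Proof. by case=> f1 _ i c a b; apply: (f1 [::]). Qed.

Lemma multilinear_comp (V W : lmodType Q) (h : {linear V -> W})
    (f : seq letter -> last_letter -> V) :
  multilinear f -> multilinear (fun w x => h (f w x)).
Proof.
by move=> [f1 f2]; split=> *; [rewrite f1 linearP | rewrite f2 linearP].
Qed.

Definition prepend a : {linear bar -> bar} :=
  bar_lift (multilinear_tail a bar_word_multilinear).

Lemma prependE a w x : prepend a (bar_word w x) = bar_word (a :: w) x.
Proof. exact: bar_liftE. Qed.

Lemma prepend_linear z : letter_linear (fun a => prepend a z).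
Proof.
move=> i c a b; move: z; apply: bar_ind => [|d t z IHt IHz|w x].
- by rewrite !linear0 addr0.
- by rewrite !linearP IHt IHz !scalerDr !scalerA [d * c]mulrC addrACA.
- by rewrite !prependE bar_word_cons.
Qed.

Fact bar_inj_linear j : linear (fun x : G j => bar_word [::] (last_of x)).
Proof. by move=> c x y; rewrite bar_word_multilinear.2. Qed.
Definition bar_inj j : {linear G j -> bar} := mklin (@bar_inj_linear j).
Lemma bar_injE j (x : G j) : bar_inj j x = bar_word [::] (last_of x).
Proof. exact: mklinE. Qed.

Definition wshape w x : seq nat * nat := (map tag w, tag x).
#[global] Arguments wshape : simpl never.

Section Proj.
Variable p : pred (seq nat * nat).

(** Both kinds of relation preserve the shape of a word, so every predicate on shapes cuts out a
    direct summand. *)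
Fact bar_proj_multilinear :
  multilinear (fun w x => if p (wshape w x) then bar_word w x else 0).
Proof.
split=> [u v i c a b x|w j c x y]; rewrite /wshape ?map_cat /=; case: ifP => _;
  by rewrite ?scaler0 ?addr0 // (bar_word_multilinear.1, bar_word_multilinear.2).
Qed.
Definition bar_proj : {linear bar -> bar} := bar_lift bar_proj_multilinear.

Lemma bar_projE w x : bar_proj (bar_word w x) = if p (wshape w x) then bar_word w x else 0.
Proof. exact: bar_liftE. Qed.
End Proj.

Lemma bar_projI p q z : bar_proj p (bar_proj q z) = bar_proj (predI p q) z.
Proof.
apply: (bar_ext (f := bar_proj p \o bar_proj q)) => w x /=.
by rewrite !bar_projE /=; case: (q _) => /=; rewrite ?bar_projE ?andbT ?andbF ?linear0.
Qed.

Lemma bar_proj_eq p q z : p =1 q -> bar_proj p z = bar_proj q z.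
Proof. by move=> pq; apply: bar_ext => w x; rewrite !bar_projE pq. Qed.
End Bar.

(** * The bar differential and its square *)

Section BarDifferential.
Variables (Q R : comNzRingType) (pi : {rmorphism Q -> R}).
Variables (A : free_resolution (restr R^o pi)) (mul : dg_algebra A).
Variables (G : complex Q) (m : ainf_module mul G).
Local Notation letter := (letter A).
Local Notation last_letter := (last_letter G).
Local Notation bar := (bar A G).
Local Notation bw := (@bar_word Q R pi A G).
Implicit Types (a b c : letter) (u v w : seq letter) (x y : last_letter) (z : bar).

Definition word_deg (s : seq nat * nat) : nat := (sumn [seq i.+2 | i <- s.1] + s.2)%N.

#[global] Arguments word_deg : simpl never.

Lemma sdegE w : sdeg w = sumn [seq i.+2 | i <- map tag w].
Proof. by rewrite /sdeg sumnE !big_map. Qed.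

Lemma word_deg_shape w x : word_deg (wshape w x) = (sdeg w + tag x)%N.
Proof. by rewrite /word_deg /= sdegE. Qed.

Lemma word_deg_cons a w x : word_deg (wshape (a :: w) x) = ((tag a).+2 + word_deg (wshape w x))%N.
Proof. by rewrite /word_deg /= addnA. Qed.

(* The summand of the differential in which one operation m_n swallows the whole word. *)
Definition mleft w x : bar :=
  bar_inj A G ((word_deg (wshape w x)).-1) (m w (tag x) (word_deg (wshape w x)).-1 (tagged x)).

Lemma mleftE n w x : (word_deg (wshape w x)).-1 = n -> mleft w x = bar_inj A G n (m w (tag x) n (tagged x)).
Proof. by move=> <-. Qed.

Fact mleft_multilinear : multilinear mleft.
Proof.
split=> [u v i c a b x|w j c x y].
- set n := (word_deg (wshape (u ++ sus a :: v) x)).-1.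
  by rewrite !(@mleftE n) ?ainf_multilinear ?linearP // /n /wshape !map_cat.
- set n := (word_deg (wshape w (last_of x))).-1.
  by rewrite !(@mleftE n) //= linearP linearP.
Qed.
Definition barM : {linear bar -> bar} := bar_lift mleft_multilinear.

Lemma barME w x : barM (bw w x) = mleft w x.
Proof. exact: bar_liftE. Qed.

Section M.
Variable n : nat.
Fact barM_at_multilinear : multilinear (fun w x => m w (tag x) n (tagged x)).
Proof. by split=> *; [rewrite ainf_multilinear | rewrite /= linearP]. Qed.
Definition barM_at : {linear bar -> G n} := bar_lift barM_at_multilinear.
Lemma barM_atE w x : barM_at (bw w x) = m w (tag x) n (tagged x).
Proof. exact: bar_liftE. Qed.
End M.

Definition homog n : {linear bar -> bar} := bar_proj A G (fun s => word_deg s == n).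

Lemma homogE n w x : homog n (bw w x) = if word_deg (wshape w x) == n then bw w x else 0.
Proof. exact: bar_projE. Qed.

Lemma homog_homog n p z : homog n (homog p z) = if n == p then homog p z else 0.
Proof.
have [->|np] := eqVneq n p.
  by rewrite /homog bar_projI; apply: bar_proj_eq => s /=; rewrite andbb.
apply: (bar_ext (f := homog n \o homog p) (g := \0)) => w x /=.
rewrite homogE; case: eqP => [d|_]; last by rewrite linear0.
by rewrite homogE d eq_sym (negPf np).
Qed.

(** Passes from [barM], whose target degree depends on the word, to a fixed target degree, where the
    A-infinity relations are stated; [ainf_degree] kills the other words. *)
Lemma barM_homog n z : barM (homog n.+1 z) = bar_inj A G n (barM_at n z).
Proof.
apply: (bar_ext (f := barM \o homog n.+1) (g := bar_inj A G n \o barM_at n)) => w x /=.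
rewrite homogE barM_atE; case: eqP => [dn|nd]; first by rewrite barME (@mleftE n) // dn.
rewrite !linear0 ainf_degree ?linear0 //.
by move=> dn; apply: nd; rewrite word_deg_shape.
Qed.

(** Letters form a sigma type without addition, so linearity of an operation on letters is expressed
    after composing with a linear [g]. *)
Lemma m1_letter_linear (V : lmodType Q) (g : letter -> V) :
  letter_linear g -> letter_linear (fun a => g (ainf_m1 a)).
Proof.
move=> g_lin [|i] c a b; rewrite /ainf_m1 /=.
  by rewrite letter_linear0 // scaler0 addr0.
by rewrite linearP opprD -scalerN g_lin.
Qed.

Lemma m2l_letter_linear (V : lmodType Q) (g : letter -> V) b :
  letter_linear g -> letter_linear (fun a => g (ainf_m2 mul a b)).
Proof.
move=> g_lin i c a a'; rewrite /ainf_m2 /= -g_lin; congr (g (sus _)).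
have := tmap_linl mul (i.+1 + (tag b).+1)%N (tagged b) c a a'; rewrite /= => ->.
by rewrite scalerDr !scalerA mulrC.
Qed.

Lemma m2r_letter_linear (V : lmodType Q) (g : letter -> V) b :
  letter_linear g -> letter_linear (fun a => g (ainf_m2 mul b a)).
Proof.
move=> g_lin i c a a'; rewrite /ainf_m2 /= -g_lin; congr (g (sus _)).
have := tmap_linr mul ((tag b).+1 + i.+1)%N (tagged b) c a a'; rewrite /= => ->.
by rewrite scalerDr !scalerA mulrC.
Qed.

(* Multiplies [a] into the first letter. *)
Definition mul_head_word a w x : bar :=
  if w is b :: w' then bw (ainf_m2 mul a b :: w') x else 0.

Fact mul_head_multilinear a : multilinear (mul_head_word a).
Proof.
apply: multilinear_cons => [w x|b|j c x y] /=.
- exact/(m2r_letter_linear (g := fun b => bw (b :: w) x))/bar_word_cons.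
- exact/multilinear_tail/bar_word_multilinear.
- by rewrite scaler0 addr0.
Qed.
Definition mul_head a : {linear bar -> bar} := bar_lift (mul_head_multilinear a).
Lemma mul_headE a w x : mul_head a (bw w x) = mul_head_word a w x.
Proof. exact: bar_liftE. Qed.

Lemma mul_head_prepend a b z : mul_head a (prepend G b z) = prepend G (ainf_m2 mul a b) z.
Proof.
apply: (bar_ext (f := mul_head a \o prepend G b)) => w x /=.
by rewrite !prependE mul_headE.
Qed.

Lemma mul_head_inj a j (x : G j) : mul_head a (bar_inj A G j x) = 0.
Proof. by rewrite bar_injE mul_headE. Qed.

Lemma mul_head_word_linear w x : letter_linear (fun a => mul_head_word a w x).
Proof.
case: w => [|b w] i c a a' /=; first by rewrite scaler0 addr0.
exact: (m2l_letter_linear b (bar_word_cons w x)).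
Qed.

(* The degree of s(a) is tag a + 2, so its Koszul sign is (-1) ^+ tag a. *)
Fixpoint barD_word w x : bar :=
  mleft w x +
  (if w is a :: w' then
     bw (ainf_m1 a :: w') x + (mul_head_word a w' x + (-1) ^+ tag a *: prepend G a (barD_word w' x))
   else 0).

Lemma letter_linearD (V : lmodType Q) (f g : letter -> V) :
  letter_linear f -> letter_linear g -> letter_linear (fun a => f a + g a).
Proof. by move=> fl gl i c a b; rewrite fl gl scalerDr addrACA. Qed.

Lemma lin_combD (V : lmodType Q) (c : Q) (s t s' t' : V) :
  (c *: s + s') + (c *: t + t') = c *: (s + t) + (s' + t').
Proof. by rewrite scalerDr addrACA. Qed.

Lemma barD_letter_linear w x : letter_linear (fun a => barD_word (a :: w) x).
Proof.
apply: letter_linearD; first exact: (multilinear_head _ _ mleft_multilinear).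
apply: letter_linearD.
  exact: (m1_letter_linear (bar_word_cons w x)).
apply: letter_linearD; first exact: mul_head_word_linear.
move=> i c a b /=; rewrite prepend_linear scalerDr !scalerA.
by rewrite mulrC.
Qed.

Fact barD_multilinear : multilinear barD_word.
Proof.
split=> [u|w].
  elim: u => [|a' u IHu] v i c a b x; first exact: barD_letter_linear.
  rewrite [LHS]/= IHu linearP scalerDr [_ *: (c *: _)]scalerA [_ * c]mulrC -scalerA.
  rewrite (mleft_multilinear.1 (a' :: u)) (mul_head_multilinear a').1.
  rewrite ((@bar_word_multilinear _ _ _ A G).1 (ainf_m1 a' :: u)).
  by rewrite !lin_combD.
elim: w => [|a w IHw] j c x y.
  by rewrite /= !addr0 mleft_multilinear.2.
rewrite [LHS]/= IHw linearP scalerDr [_ *: (c *: _)]scalerA [_ * c]mulrC -scalerA.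
rewrite mleft_multilinear.2 (mul_head_multilinear a).2 (@bar_word_multilinear _ _ _ A G).2.
by rewrite !lin_combD.
Qed.

Definition barD : {linear bar -> bar} := bar_lift barD_multilinear.
Lemma barDE w x : barD (bw w x) = barD_word w x.
Proof. exact: bar_liftE. Qed.

(** The part of the differential that keeps at least one letter, hence is invisible to the
    projection onto G. *)
Definition barN_word w x : bar :=
  if w is a :: w' then
    bw (ainf_m1 a :: w') x + (mul_head_word a w' x + (-1) ^+ tag a *: prepend G a (barD_word w' x))
  else 0.

Fact barN_linear : linear (barD \- barM : bar -> bar).
Proof. exact: linearP. Qed.

Definition barN : {linear bar -> bar} := mklin barN_linear.

Lemma barDN z : barD z = barM z + barN z.
Proof. by rewrite mklinE /= addrC subrK. Qed.

Lemma barNE w x : barN (bw w x) = barN_word w x.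
Proof. by rewrite mklinE /= barDE barME; case: w => *; rewrite /= addrC addKr. Qed.

Lemma barN_prepend a z : barN (prepend G a z) =
  prepend G (ainf_m1 a) z + (mul_head a z + (-1) ^+ tag a *: prepend G a (barD z)).
Proof.
apply: (bar_ext (f := barN \o prepend G a)
  (g := prepend G (ainf_m1 a) \+ (mul_head a \+ ((-1) ^+ tag a \*: (prepend G a \o barD))))) => w x.
by rewrite /= !prependE mul_headE barNE barDE.
Qed.

Lemma barN_inj j (x : G j) : barN (bar_inj A G j x) = 0.
Proof. by rewrite bar_injE barNE. Qed.

Lemma barD_inj j (x : G j) : barD (bar_inj A G j x) = bar_inj A G j.-1 (dif G j x).
Proof.
rewrite barDN barN_inj addr0 bar_injE barME (@mleftE j.-1) //=.
by rewrite ainf_map1.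
Qed.

End BarDifferential.

Section BarSquare.
Variables (Q R : comNzRingType) (pi : {rmorphism Q -> R}).
Variables (A : free_resolution (restr R^o pi)) (mul : dg_algebra A).
Variables (G : complex Q) (m : ainf_module mul G).
Local Notation letter := (letter A).
Local Notation last_letter := (last_letter G).
Local Notation bar := (bar A G).
Local Notation bw := (@bar_word Q R pi A G).
Local Notation barD := (barD m).
Local Notation barM := (barM m).
Local Notation barN := (barN m).
Local Notation homog := (homog A G).
Local Notation mleft := (mleft m).
Local Notation bar_inj := (bar_inj A G).
Local Notation prepend := (prepend G).
Implicit Types (a b : letter) (u v w : seq letter) (x y : last_letter) (z : bar).

(* The summands of [ainf_rel], before the outermost operation is applied. *)
Definition bar_term w x (i t : nat) : bar :=
  (-1) ^+ sdeg (take t w) *: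
  (if t == ((size w).+1 - i)%N
   then let l := (sdeg (drop t w) + tag x).-1 in
        bw (take t w) (last_of (m (drop t w) (tag x) l (tagged x)))
   else bw (take t w ++ ainf_m mul (take i (drop t w)) :: drop (t + i) w) x).

Lemma sdeg_cons a w : sdeg (a :: w) = ((tag a).+2 + sdeg w)%N.
Proof. exact: big_cons. Qed.

Lemma bar_term0 w x : bar_term w x (size w).+1 0 = mleft w x.
Proof.
rewrite /bar_term subnn eqxx take0 drop0 /sdeg big_nil expr0 scale1r.
by rewrite /mleft word_deg_shape bar_injE.
Qed.

Lemma bar_term_cons a w x i t : (i <= (size w).+1)%N ->
  bar_term (a :: w) x i t.+1 = (-1) ^+ tag a *: prepend a (bar_term w x i t).
Proof.
move=> iw; rewrite /bar_term /= linearZ_LR scalerA sdeg_cons exprD !exprSr.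
rewrite !mulrN1 opprK; congr (_ *: _).
by rewrite subSn // eqSS; case: ifP => _; rewrite prependE.
Qed.

(** The recursion peels off the first letter while [ainf_rel] sums over positions: terms with t > 0
    come from the tail, terms with t = 0 are those added by the recursion step. *)
Lemma barD_word_sum w x : barD_word m w x =
  \sum_(1 <= i < (size w).+2) \sum_(0 <= t < ((size w).+1 - i).+1) bar_term w x i t.
Proof.
elim: w => [|a w IHw].
  by rewrite !big_nat1 (bar_term0 [::]) /= addr0.
rewrite [LHS]/= IHw linear_sum scaler_sumr.
under [RHS]eq_big_nat => i /andP[i0 iw] do rewrite big_nat_recl //.
rewrite big_split /= [X in _ = _ + X]big_nat_recr //= [X in _ = _ + (_ + X)]big_geq ?subnn // addr0 !addrA.
congr (_ + _); last first.
  apply: eq_big_nat => i /andP[i0 iw]; rewrite linear_sum scaler_sumr.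
  by rewrite (@subSn i (size w).+1) //; apply: eq_bigr => t _; rewrite bar_term_cons.
rewrite [RHS]big_nat_recr //= (bar_term0 (a :: w)) [RHS]addrC -addrA; congr (_ + _).

rewrite big_nat_recl //.
rewrite {1}/bar_term /= take0 drop0 /sdeg big_nil expr0 scale1r; congr (_ + _).
case: w {IHw} => [|b w]; first by rewrite big_geq.
rewrite big_nat_recl // big_nat_cond big1 ?addr0 => [|i /andP[/andP[i0 iw] _]].
  by rewrite /bar_term /= ?take0 ?drop0 /sdeg big_nil expr0 scale1r.
(* Here i >= 3 and the operation takes letters only; it vanishes because A is a dg-algebra. *)
rewrite /bar_term /= ifN; last by rewrite eq_sym -lt0n subn_gt0; exact: iw.
case: i i0 iw => //= i _ iw; case: w iw => //= c w iw.
by rewrite (letter_linear0 _ (bar_word_cons _ _)) scaler0.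
Qed.

Lemma barM_at_barD w x : (2 <= size w)%N ->
  barM_at m (sdeg w + tag x).-2 (barD (bw w x)) = 0.
Proof.
move=> w2; rewrite barDE barD_word_sum -[RHS](ainf_rel m (tagged x) w2).
rewrite linear_sum; apply: eq_bigr => i _; rewrite linear_sum; apply: eq_bigr => t _.
by rewrite /bar_term linearZ_LR; congr (_ *: _); case: ifP => _; rewrite barM_atE.
Qed.

(** The component of the differential of A that [ainf_m1] discards. *)
Definition curv a : Q :=
  match tag a as i return A i.+1 -> Q with
  | 0%N => fun a1 : A 1%N => dg_coord mul (dif A 1%N a1)
  | _.+1 => fun=> 0
  end (tagged a).

Lemma d1_tensorE a j (x : G j) :
  bar_inj (tag a + j) (d1_tensor mul a x) = curv a *: bw [::] (last_of x).
Proof.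
case: a => -[|i] a; rewrite /d1_tensor /curv /=; last by rewrite linear0 scale0r.
by rewrite linearZ_LR bar_injE.
Qed.

Lemma curv_linear i c (a b : A i.+1) : curv (sus (c *: a + b)) = c * curv (sus a) + curv (sus b).
Proof.
by case: i a b => [|i] a b; rewrite /curv /= ?mulr0 ?addr0 // linearP linearP.
Qed.

Lemma barM_at_barD1 a x : barM_at m (tag a + tag x) (barD (bw [:: a] x)) = d1_tensor mul a (tagged x).
Proof.
rewrite barDE -(ainf_rel2 m a (tagged x)) /= addr0 add0r.
rewrite (@mleftE _ _ _ _ _ _ _ (tag a + tag x).+1); last by rewrite word_deg_shape sdeg_cons /sdeg big_nil addn0.
rewrite (@mleftE _ _ _ _ _ _ _ (tag x).-1); last by rewrite word_deg_shape /sdeg big_nil.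
rewrite !linearD !linearZ_LR /= !bar_injE prependE !barM_atE /=.
by rewrite !exprSr !mulrN1 opprK.
Qed.

Lemma m1_tag0 (V : lmodType Q) (g : letter -> V) a : letter_linear g -> tag a = 0%N ->
  g (ainf_m1 a) = 0.
Proof.
by case: a => i a g_lin /= i0; case: _ / (esym i0) in a *; apply: letter_linear0.
Qed.

Lemma m1_tagS a i : tag a = i.+1 -> tag (ainf_m1 a) = i.
Proof. by case: a => j a /= ji; case: _ / (esym ji) in a *. Qed.

(** The truncated predecessor makes degree 0 map to degree 0; this is harmless because [dif 0] is
    zero. *)
Lemma deg0_barD w x : word_deg (wshape w x) = 0%N -> barD_word m w x = 0.
Proof.
case: w => [|a w]; last by rewrite word_deg_cons.
case: x => -[|j] x //= _.
by rewrite addr0 (@mleftE _ _ _ _ _ _ _ 0%N) // [m _ _ _ _](@ainf_map1 _ _ _ _ _ _ m 0%N) dif0 linear0.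
Qed.

Lemma homog_prepend n a z : homog ((tag a).+2 + n) (prepend a z) = prepend a (homog n z).
Proof.
apply: (bar_ext (f := homog ((tag a).+2 + n) \o prepend a) (g := prepend a \o homog n)) => w x.
by rewrite /= prependE !homogE word_deg_cons eqn_add2l; case: ifP; rewrite ?prependE ?linear0.
Qed.

Lemma homog_word w x : homog (word_deg (wshape w x)) (bw w x) = bw w x.
Proof. by rewrite homogE eqxx. Qed.

Lemma homog_inj n (x : G n) : homog n (bar_inj n x) = bar_inj n x.
Proof. by rewrite bar_injE; apply: (homog_word [::] (last_of x)). Qed.

Lemma homog_barD_word w x :
  homog (word_deg (wshape w x)).-1 (barD_word m w x) = barD_word m w x.
Proof.
elim: w => [|a w IHw]; first by rewrite /= !addr0 homog_inj.
have -> : (word_deg (wshape (a :: w) x)).-1 = ((tag a).+1 + word_deg (wshape w x))%N.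
  by rewrite word_deg_cons.
set d := word_deg (wshape w x) in IHw *.
rewrite /= !linearD /=; congr (_ + (_ + (_ + _))).
- by rewrite (@mleftE _ _ _ _ _ _ _ ((tag a).+1 + d)%N) ?homog_inj // word_deg_cons.
- case ta: (tag a) => [|i].
    by rewrite (m1_tag0 (bar_word_cons w x) ta) linear0.
  by rewrite -[in RHS]homog_word word_deg_cons (m1_tagS ta).
- case: w @d {IHw} => [|b w] d /=; first by rewrite linear0.
  rewrite -[in RHS]homog_word word_deg_cons /d word_deg_cons; congr (homog _ _).
  by rewrite /= !addnS !addSn !addnA.
- rewrite linearZ_LR; congr (_ *: _).
  case dw: d IHw => [|n] IHw; first by rewrite deg0_barD // !linear0.
  by rewrite addnS -addSn homog_prepend IHw.
Qed.

Lemma homog_barD n z : homog n (barD z) = barD (homog n.+1 z).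
Proof.
apply: (bar_ext (f := homog n \o barD) (g := barD \o homog n.+1)) => w x /=.
rewrite homogE barDE -homog_barD_word homog_homog.
case dw: (word_deg (wshape w x)) => [|d]; last first.
  rewrite /= eqSS eq_sym; case: ifP => _; rewrite ?linear0 //.
  by rewrite barDE -{2}homog_barD_word dw.
by rewrite !deg0_barD // linear0 if_same linear0.
Qed.

Lemma bw_nil x : bw [::] x = bar_inj (tag x) (tagged x).
Proof. by rewrite bar_injE; case: x. Qed.

Lemma barM_barD w x :
  barM (barD (bw w x)) = if w is [:: a] then curv a *: bw [::] x else 0.
Proof.
case: w => [|a w].
  rewrite bw_nil barD_inj bar_injE barME (@mleftE _ _ _ _ _ _ _ (tag x).-1.-1) //=.
  by rewrite ainf_map1 difK linear0.
pose n := (sdeg (a :: w) + tag x).-2.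
have dn : word_deg (wshape (a :: w) x) = n.+2 by rewrite /n word_deg_shape sdeg_cons.
rewrite -(homog_word (a :: w)) dn -homog_barD barM_homog /n.
case: w {dn n} => [|b w]; last by rewrite barM_at_barD ?linear0.
have -> : (sdeg [:: a] + tag x).-2 = (tag a + tag x)%N.
  by rewrite sdeg_cons /sdeg big_nil addn0.
by rewrite barM_at_barD1 d1_tensorE; case: (x).
Qed.

Fact curv_multilinear :
  multilinear (fun w x => if w is a :: w' then curv a *: bw w' x else 0).
Proof.
apply: multilinear_cons => [w x|a|j c x y].
- by move=> i c a b; rewrite curv_linear scalerDl scalerA.
- exact: (multilinear_comp ( *:%R (curv a)) (@bar_word_multilinear _ _ _ A G)).
- by rewrite scaler0 addr0.
Qed.
Definition bar_curv : {linear bar -> bar} := bar_lift curv_multilinear.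
Lemma bar_curvE w x : bar_curv (bw w x) = if w is a :: w' then curv a *: bw w' x else 0.
Proof. exact: bar_liftE. Qed.

Lemma bar_curv_prepend a z : bar_curv (prepend a z) = curv a *: z.
Proof.
by apply: (bar_ext (f := bar_curv \o prepend a) (g := curv a \*: idfun)) => w x; rewrite /= prependE bar_curvE.
Qed.

Lemma mulZl i j n (c : Q) (a : A i) (b : A j) : mul i j n (c *: a) b = c *: mul i j n a b.
Proof. by rewrite -(mklinE (tmap_linl mul n b)) linearZ_LR mklinE. Qed.

Lemma mulZr i j n (c : Q) (a : A i) (b : A j) : mul i j n a (c *: b) = c *: mul i j n a b.
Proof. by rewrite -(mklinE (tmap_linr mul n a)) linearZ_LR mklinE. Qed.

Lemma mulNl i j n (a : A i) (b : A j) : mul i j n (- a) b = - mul i j n a b.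
Proof. by rewrite -!scaleN1r mulZl. Qed.

Lemma mulNr i j n (a : A i) (b : A j) : mul i j n a (- b) = - mul i j n a b.
Proof. by rewrite -!scaleN1r mulZr. Qed.

(** Equality of letters in the sigma type replaces a cast between the modules of equal degree. *)
Lemma sus_mul_eq i j n p (a : A i) (b : A j) : n = p ->
  sus (mul i j n.+1 a b) = sus (mul i j p.+1 a b).
Proof. by move=> ->. Qed.

Section Letters.
Variables (V : lmodType Q) (g : letter -> V).
Hypothesis g_lin : letter_linear g.

(** The sign that the shift puts into m_2 turns associativity into this cancellation. *)
Lemma ainf_m2_assoc a b (c : letter) :
  g (ainf_m2 mul (ainf_m2 mul a b) c)
  + (-1) ^+ tag a *: g (ainf_m2 mul a (ainf_m2 mul b c)) = 0.
Proof.
case: a b c => [i a] [j b] [l c]; rewrite /ainf_m2 /= mulZl mulZr.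
rewrite !(letter_linearZ _ _ g_lin) !scalerA.
have e : (i + (j + l.+1).+1 = i + j.+1 + l.+1)%N by rewrite -addnA.
rewrite (sus_mul_eq _ _ e) -(dg_mulA mul a b c) -scalerDl.
rewrite (_ : _ + _ = 0 :> Q) ?scale0r // addnS !exprS exprD.
by ring.
Qed.

Lemma letter_linearN i (a : A i.+1) : g (sus (- a)) = - g (sus a).
Proof. by rewrite -scaleN1r letter_linearZ // scaleN1r. Qed.

Lemma m1_m2 i j (a : A i.+1) (b : A j.+1) :
  g (ainf_m1 (ainf_m2 mul (sus a) (sus b))) =
  (-1) ^+ i *: g (sus (mul i j.+1 (i + j).+1 (dif A i.+1 a) b))
  - g (sus (mul i.+1 j (i + j).+1 a (dif A j.+1 b))).
Proof.
rewrite /ainf_m2 /=.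
have e : (i + j.+1 = (i + j).+1)%N by rewrite addnS.
have := tmap_dif mul a b; rewrite -[(i.+1 + j.+1)%N]/((i + j.+1).+1) /= e => dab.
rewrite /ainf_m1 /= linearZ_LR dab exprS mulN1r -scaleNr opprK letter_linearZ //.
rewrite [X in sus X]addrC g_lin scalerDr scalerA mulrN -expr2 sqrr_sign scaleN1r.
by rewrite addrC.
Qed.

Lemma m2_m1l i j (a : A i.+1) (b : A j.+1) :
  g (ainf_m2 mul (ainf_m1 (sus a)) (sus b))
  + (-1) ^+ i *: g (sus (mul i j.+1 (i + j).+1 (dif A i.+1 a) b)) =
  curv (sus a) *: g (sus b).
Proof.
case: i a => [|i] a.
  rewrite /ainf_m1 /= (letter_linear0 _ (m2l_letter_linear mul (sus b) g_lin)).
  rewrite add0r expr0 scale1r /curv /= -(dg_coordK mul (dif A 1 a)) mulZl dg_mul1.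
  by rewrite letter_linearZ // dg_coordK.
rewrite /ainf_m1 /ainf_m2 /= mulNl letter_linearZ // letter_linearN.
have e : (i + j.+1 = i.+1 + j)%N by rewrite addnS.
by rewrite (sus_mul_eq _ _ e) scalerN addNr /curv scale0r.
Qed.

Lemma m2_m1r i j (a : A i.+1) (b : A j.+1) :
  (-1) ^+ i *: g (ainf_m2 mul (sus a) (ainf_m1 (sus b)))
  - g (sus (mul i.+1 j (i + j).+1 a (dif A j.+1 b))) = - (curv (sus b) *: g (sus a)).
Proof.
case: j b => [|j] b.
  rewrite /ainf_m1 /= (letter_linear0 _ (m2r_letter_linear mul (sus a) g_lin)).
  rewrite scaler0 add0r /curv /= -{1}(dg_coordK mul (dif A 1 b)) mulZr.
  by rewrite letter_linearZ // (sus_mul_eq _ _ (addn0 i)) dg_mulr1.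
rewrite /ainf_m1 /ainf_m2 /= mulNr letter_linearZ // letter_linearN.
rewrite !scalerN scalerA exprS mulN1r mulrN -expr2 sqrr_sign scaleN1r opprK subrr.
by rewrite /curv scale0r oppr0.
Qed.

(** The Leibniz rule of [mul]. The right-hand side consists of the terms in which d_1 lands in A_0 =
    Q and acts by scalars, which [ainf_m1] omits. *)
Lemma ainf_m2_leibniz a b :
  g (ainf_m1 (ainf_m2 mul a b)) + g (ainf_m2 mul (ainf_m1 a) b)
  + (-1) ^+ tag a *: g (ainf_m2 mul a (ainf_m1 b)) = curv a *: g b - curv b *: g a.
Proof.
case: a b => [i a] [j b]; have := m2_m1l a b; have := m2_m1r a b.
rewrite -[existT _ i a]/(sus a) -[existT _ j b]/(sus b) m1_m2 /= => <- <-.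
have zmodE (p q r s : V) : p - q + r + s = r + p + (s - q).
  by rewrite [p - q + r]addrAC [p + r - q + s]addrAC -[p + r + s - q]addrA [p + r]addrC.
exact: zmodE.
Qed.
End Letters.

Lemma prepend_m1m1 a z : prepend (ainf_m1 (ainf_m1 a)) z = 0.
Proof.
have p_lin := @prepend_linear _ _ _ A G z.
case: a => -[|[|i]] a; rewrite /ainf_m1 /= ?(letter_linear0 _ p_lin) //.
rewrite linearN opprK (difK a : dif A i.+2 (dif A i.+3 a) = 0).
exact: (letter_linear0 i p_lin).
Qed.

Lemma mul_head_assoc a b z :
  mul_head mul G (ainf_m2 mul a b) z + (-1) ^+ tag a *: mul_head mul G a (mul_head mul G b z) = 0.
Proof.
apply: (bar_ext (f := mul_head mul G (ainf_m2 mul a b) \+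
  ((-1) ^+ tag a \*: (mul_head mul G a \o mul_head mul G b))) (g := \0)) => w x.
rewrite /= !mul_headE; case: w => [|c w] /=; first by rewrite linear0 scaler0 addr0.
by rewrite mul_headE; apply: (ainf_m2_assoc (g := fun a => bw (a :: w) x)); apply: bar_word_cons.
Qed.

(** [ainf_m1] lowers the tag by one and so flips the sign; at tag 0 the tag stays, but the letter is
    zero. *)
Lemma sign_prepend_m1 a z :
  (-1) ^+ tag (ainf_m1 a) *: prepend (ainf_m1 a) z = - ((-1) ^+ tag a *: prepend (ainf_m1 a) z).
Proof.
case ta: (tag a) => [|i]; last by rewrite (m1_tagS ta) exprS mulN1r scaleNr opprK.
by rewrite (m1_tag0 (prepend_linear (G := G) z) ta) !scaler0 oppr0.
Qed.

(** Induction on the word. The component in G is given by the A-infinity relations of G; the rest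
    reduces to the Leibniz rule and associativity for the first two letters, and to the tail. *)
Lemma barD2 z : barD (barD z) = bar_curv z.
Proof.
apply: (bar_ext (f := barD \o barD)) => w x /=; rewrite bar_curvE.
elim: w => [|a w IHw].
  by rewrite bw_nil !barD_inj difK linear0.
rewrite [LHS]barDN barM_barD (barDN m (bw _ _)) linearD barME barN_inj add0r -prependE.
set z0 := bw w x in IHw *.
rewrite barN_prepend !linearD linearZ_LR !barN_prepend /= prepend_m1m1 add0r IHw.
rewrite sign_prepend_m1 !scalerDr scalerA -expr2 sqrr_sign scale1r.
set X := _ *: prepend (ainf_m1 a) _.
have -> (V : zmodType) (t0 t1 t2 t3 t4 t5 : V) :
    t0 + (t1 - t2 + (t3 + (t2 + (t4 + t5)))) = t0 + (t1 + t3 + t4 + t5).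
  by rewrite [t3 + _]addrCA [t1 - t2 + _]addrA subrK !addrA.
case: w @z0 X IHw => [|b w] z0 _ IHw.
  by rewrite linear0 /z0 bw_nil barD_inj !mul_head_inj linear0 scaler0 !addr0.
set y := bw w x; have z0E : z0 = prepend b y by rewrite prependE.
rewrite barDN z0E !mul_head_prepend linearD [mul_head _ _ _ (barM _)](_ : _ = 0); last first.
  by rewrite prependE barME mul_head_inj.
have -> : mul_head mul G a (barN (prepend b y)) = prepend (ainf_m2 mul a (ainf_m1 b)) y +
    (mul_head mul G a (mul_head mul G b y) + (-1) ^+ tag b *: prepend (ainf_m2 mul a b) (barD y)).
  by rewrite barN_prepend linearD mul_head_prepend linearD linearZ_LR mul_head_prepend.
rewrite add0r barN_prepend.
have := mul_head_assoc a b y; have := ainf_m2_leibniz (prepend_linear (G := G) y) a b.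
rewrite /= -z0E => L S.
(* The Leibniz rule yields the curvature of a minus that of b; the latter cancels the curvature of
   the tail, supplied by the induction hypothesis. *)
rewrite -(subrK (curv b *: prepend a y) (curv a *: z0)) -L linearZ_LR !scalerDr.
rewrite scalerA exprD exprS mulN1r mulrN scaleNr.
set K := (_ * _) *: prepend _ (barD y).
have zmodE (V : zmodType) (p1 p2 p3 u v k c : V) : u + v = 0 ->
    0 + (p2 + (p1 + (u - k)) + (p3 + (v + k)) + c) = p1 + p2 + p3 + c.
  move=> uv; rewrite add0r; congr (_ + _).
  rewrite [v + k]addrC !addrA [p2 + p1]addrC -[RHS]addr0 -uv.
  rewrite -![in LHS]addrA -![in RHS]addrA; congr (_ + (_ + _)).
  by rewrite [p3 + (k + v)]addrCA addKr addrCA.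
by rewrite (zmodE _ _ _ _ _ _ _ _ S).
Qed.
End BarSquare.

(** * Exactness of the bar complex modulo the kernel of Q -> R *)

Section Component.
Variables (S : comNzRingType) (X : nat -> lmodType S).

Definition component n (x : {i : nat & X i}) : X n :=
  if tag x =P n is ReflectT e then etagged e else 0.

Lemma component_id n (x : X n) : component n (Tagged (fun i => X i) x) = x.
Proof. by rewrite /component; case: eqP => //= e; rewrite /etagged eq_axiomK. Qed.

Lemma component_neq n i (x : X i) : i <> n -> component n (Tagged (fun i => X i) x) = 0.
Proof. by rewrite /component /=; case: eqP. Qed.

Lemma component_linear n i : linear (fun x : X i => component n (Tagged (fun i => X i) x)).
Proof.
move=> c x y; have [ni|/eqP ni] := eqVneq i n; last by rewrite !component_neq // scaler0 addr0.
by case: _ / ni; rewrite !component_id.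
Qed.
End Component.

Section BarExact.
Variables (Q R : comNzRingType) (pi : {rmorphism Q -> R}).
Variables (A : free_resolution (restr R^o pi)) (mul : dg_algebra A).
Variables (G : complex Q) (m : ainf_module mul G).
Variables (bA : forall i, basis (A i.+1)) (bG : forall j, basis (G j)).
Local Notation letter := (letter A).
Local Notation last_letter := (last_letter G).
Local Notation bar := (bar A G).
Local Notation bw := (@bar_word Q R pi A G).
Local Notation barD := (barD m).
Local Notation homog := (homog A G).
Local Notation bar_inj := (bar_inj A G).
Local Notation prepend := (prepend G).
Local Notation bar_curv := (bar_curv mul G).
Implicit Types (a b : letter) (u v w : seq letter) (x y : last_letter) (z r : bar).

Definition bword : choiceType :=
  (seq {i : nat & bas_index (bA i)} * {j : nat & bas_index (bG j)})%type.
Implicit Type e : {i : nat & bas_index (bA i)}.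
Implicit Type g : {j : nat & bas_index (bG j)}.

Definition blet e : letter := sus (bas_elt (tagged e)).
Definition blast g : last_letter := last_of (bas_elt (tagged g)).
Definition bbw (p : bword) : bar := bw (map blet p.1) (blast p.2).

Definition letcomp i (a : letter) : A i.+1 := component (X := fun i => A i.+1) i a.

Lemma letcomp_linear n : letter_linear (letcomp n).
Proof. by move=> i c a b; apply: (component_linear (X := fun i => A i.+1)). Qed.

Definition lcoord e a : Q := bas_coord (tagged e) (letcomp (tag e) a).
Definition gcoord g x : Q := bas_coord (tagged g) (component (tag g) x).

Fixpoint wcoord es g w x : Q :=
  match es, w with
  | [::], [::] => gcoord g x
  | e :: es', a :: w' => lcoord e a * wcoord es' g w' x
  | _, _ => 0
  end.

Lemma lcoord_linear e i c (a b : A i.+1) :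
  lcoord e (sus (c *: a + b)) = c * lcoord e (sus a) + lcoord e (sus b).
Proof. by rewrite /lcoord letcomp_linear linearP. Qed.

Fact wcoord_multilinear (p : bword) : multilinear (fun w x => wcoord p.1 p.2 w x : Q^o).
Proof.
case: p => es g; elim: es => [|e es IHes] /=; split.
- move=> [|? ?] *; by rewrite /= ?scaler0 ?addr0.
- move=> [|? ?] * /=; last by rewrite scaler0 addr0.
  by rewrite /gcoord /last_of component_linear linearP.
- move=> [|a' u] v i c a b x /=.
    by rewrite lcoord_linear mulrDl scalerAl.
  by rewrite IHes.1 mulrDr scalerAr.
- move=> [|a' w] j c x y /=; first by rewrite scaler0 addr0.
  by rewrite IHes.2 mulrDr scalerAr.
Qed.
Definition coord (p : bword) : {linear bar -> Q^o} := bar_lift (wcoord_multilinear p).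
Lemma coordE p w x : coord p (bw w x) = wcoord p.1 p.2 w x.
Proof. exact: bar_liftE. Qed.

Lemma lcoord_blet e e' : lcoord e (blet e') = (e == e')%:R.
Proof.
case: e e' => [i e] [j e']; rewrite /lcoord /blet /letcomp /sus /=.
have [ij|/eqP ij] := eqVneq j i; last first.
  rewrite component_neq // linear0 -tag_eqE /tag_eq /=.
  by case: eqP => // /esym.
case: _ / ij in e *; rewrite (component_id (X := fun i => A i.+1)) bas_dual.
by rewrite -tag_eqE /tag_eq /= eqxx tagged_asE.
Qed.

Lemma gcoord_blast g g' : gcoord g (blast g') = (g == g')%:R.
Proof.
case: g g' => [i g] [j g']; rewrite /gcoord /blast /last_of /=.
have [ij|/eqP ij] := eqVneq j i; last first.
  rewrite component_neq // linear0 -tag_eqE /tag_eq /=.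
  by case: eqP => // /esym.
case: _ / ij in g *; rewrite component_id bas_dual.
by rewrite -tag_eqE /tag_eq /= eqxx tagged_asE.
Qed.

Lemma coord_bbw p q : coord p (bbw q) = (p == q)%:R.
Proof.
case: p q => es g [es' g']; rewrite /bbw coordE /=.
elim: es es' => [|e es IHes] [|e' es'] //=; first by rewrite gcoord_blast.
by rewrite lcoord_blet IHes -!pair_eqE /pair_eq /= -natrM mulnb andbA.
Qed.

Fact psus_linear i t : linear (fun a : A i.+1 => prepend (sus a) t).
Proof. by move=> c a b; apply: prepend_linear. Qed.
Definition psus i t : {linear A i.+1 -> bar} := mklin (@psus_linear i t).
Lemma psusE i t (a : A i.+1) : psus i t a = prepend (sus a) t.
Proof. exact: mklinE. Qed.

Lemma bbw_span z : span (fun t => exists p, t = bbw p) z.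
Proof.
move: z; apply: bar_ind => [|c t z ? ?|w x]; [exact: span0|exact: spanP|].
elim: w => [|a w IHw].
  rewrite bw_nil; move: (bas_span (bG (tag x)) (tagged x)).
  apply: span_linear => _ [g ->]; apply: span_gen.
  by exists ([::], Tagged (fun j => bas_index (bG j)) g); rewrite bar_injE.
rewrite -prependE; apply: span_linear IHw => _ [p ->].
case: a => i a; rewrite -psusE; move: (bas_span (bA i) a).
apply: span_linear => _ [e ->]; apply: span_gen.
exists (Tagged (fun i => bas_index (bA i)) e :: p.1, p.2).
by rewrite psusE prependE.
Qed.

Section FirstCoord.
Variables (i : nat) (p : bword).

Fact first_multilinear :
  multilinear (fun w x => if w is a :: w' then coord p (bw w' x) *: letcomp i a else 0).
Proof.
apply: multilinear_cons => [w x|a|j c x y].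
- by move=> j c a b; rewrite letcomp_linear scalerDr !scalerA mulrC.
- have h_lin : linear (fun t => (coord p t : Q) *: letcomp i a).
    by move=> c t z; rewrite linearP scalerDl scalerA.
  have := multilinear_comp (mklin h_lin) (@bar_word_multilinear _ _ _ A G).
  by under eq_fun => w do under eq_fun => x do rewrite mklinE.
- by rewrite scaler0 addr0.
Qed.
(* Writing z = z' + sum of [y_p|p] with y_p in A_(i+1), p a basis word and no
   letter of degree i+1 leading z', this is y_p. *)
Definition first_coord : {linear bar -> A i.+1} := bar_lift first_multilinear.
Lemma first_coordE w x : first_coord (bw w x) =
  if w is a :: w' then coord p (bw w' x) *: letcomp i a else 0.
Proof. exact: bar_liftE. Qed.

Lemma first_coord_prepend a z : first_coord (prepend a z) = coord p z *: letcomp i a.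
Proof.
have h_lin : linear (fun t => (coord p t : Q) *: letcomp i a).
  by move=> c t u; rewrite linearP scalerDl scalerA.
rewrite -(mklinE h_lin); apply: (bar_ext (f := first_coord \o prepend a)) => w x.
by rewrite mklinE /= prependE first_coordE.
Qed.

Lemma first_coord_inj j (x : G j) : first_coord (bar_inj j x) = 0.
Proof. by rewrite bar_injE first_coordE. Qed.
End FirstCoord.

Definition first_tag (q : pred nat) : {linear bar -> bar} :=
  bar_proj A G (fun s => if s.1 is i :: _ then q i else false).

Lemma first_tag_nil q x : first_tag q (bw [::] x) = 0.
Proof. by rewrite bar_projE. Qed.

Lemma first_tag_cons q a w x :
  first_tag q (bw (a :: w) x) = if q (tag a) then bw (a :: w) x else 0.
Proof. by rewrite bar_projE. Qed.

Lemma first_tag_prepend q a z : first_tag q (prepend a z) = if q (tag a) then prepend a z else 0.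
Proof.
case: ifP => qa.
  by apply: (bar_ext (f := first_tag q \o prepend a)) => w x; rewrite /= prependE first_tag_cons qa.
by apply: (bar_ext (f := first_tag q \o prepend a) (g := \0)) => w x;
   rewrite /= prependE first_tag_cons qa.
Qed.

Lemma first_expand i z : exists s : seq bword, first_tag (pred1 i) z =
  \sum_(p <- s) psus i (bbw p) (first_coord i p z).
Proof.
(* Allowing every larger duplicate-free list lets the finite supports of two elements be merged in a
   sum. *)
pose K z := exists s : seq bword, forall s', uniq s' -> {subset s <= s'} ->
  first_tag (pred1 i) z = \sum_(p <- s') psus i (bbw p) (first_coord i p z).
suff [s sP] : K z.
  by exists (undup s); apply: sP => [|p]; rewrite ?undup_uniq ?mem_undup.
have K0 : K 0 by exists [::] => s' _ _; rewrite linear0 big1 // => p _; rewrite !linear0.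
have KP c (t u : bar) : K t -> K u -> K (c *: t + u).
  move=> [s1 s1P] [s2 s2P]; exists (s1 ++ s2) => s' s'_uniq s's.
  rewrite linearP (s1P s') ?(s2P s') // => [|p ps|p ps];
    try by apply: s's; rewrite mem_cat ps ?orbT.
  by rewrite scaler_sumr -big_split; apply: eq_bigr => p _; rewrite !linearP.
move: z; apply: bar_ind => // w x; case: w => [|a w].
  exists [::] => s' _ _; rewrite first_tag_nil big1 // => p _.
  by rewrite first_coordE linear0.
rewrite -prependE; move: (bw w x) (bbw_span (bw w x)).
suff Kp p : K (prepend a (bbw p)).
  apply: span_ind => [|c _ t [p ->] Kt]; first by rewrite linear0.
  by rewrite linearP; apply: KP.
exists [:: p] => s' s'_uniq s's; rewrite first_tag_prepend.
rewrite (bigD1_seq p) ?s's ?mem_head //= big1 => [|q qp].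
  rewrite addr0 first_coord_prepend coord_bbw eqxx scale1r psusE.
  case: a => j a; rewrite /letcomp /=; have [ji|/eqP ji] := eqVneq j i.
    by case: _ / ji; rewrite (component_id (X := fun i => A i.+1)).
  by rewrite component_neq // -psusE linear0.
by rewrite first_coord_prepend coord_bbw (negPf qp) scale0r linear0.
Qed.

(** Through this, vanishing of the curvature says that the leading coordinates in A_1 are cycles. *)
Lemma coord_bar_curv p z : coord p (bar_curv z) = dg_coord mul (dif A 1 (first_coord 0 p z)).
Proof.
apply: (bar_ext (f := coord p \o bar_curv) (g := dg_coord mul \o dif A 1 \o first_coord 0 p)).
move=> w x /=; rewrite bar_curvE first_coordE; case: w => [|a w]; first by rewrite !linear0.
rewrite !linearZ_LR /=; case: a => -[|i] a; rewrite /curv /letcomp /=.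
  rewrite (component_id (X := fun i => A i.+1)) /GRing.scale /=.
  by rewrite mulrC.
by rewrite component_neq // !linear0 scale0r.
Qed.

(** Among words whose leading tag exceeds i, only m_1 can produce leading tag i: m_2 raises the tag,
    operations on the tail keep it, and a swallowed word ends in G. *)
Lemma first_coord_barD i p z :
  first_coord i p (barD (first_tag (fun j => (i < j)%N) z)) = - dif A i.+2 (first_coord i.+1 p z).
Proof.
have f_lin : linear (fun z => - dif A i.+2 (first_coord i.+1 p z)).
  by move=> c t u; rewrite linearP linearP opprD scalerN.
rewrite -(mklinE f_lin).
apply: (bar_ext (f := first_coord i p \o barD \o first_tag (fun j => (i < j)%N))) => w x.
rewrite mklinE /= first_coordE.
case: w => [|a w]; first by rewrite first_tag_nil !linear0.
have neq0 j (b : A j.+1) : j <> i -> letcomp i (sus b) = 0.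
  by move=> ji; apply: (component_neq (X := fun i => A i.+1)).
rewrite first_tag_cons; case: ifP => ia; last first.
  case: a ia => j a /= /negbT; rewrite -leqNgt => ji.
  rewrite !linear0 /letcomp component_neq ?scaler0 ?linear0 ?oppr0 // => ij.
  by rewrite ij ltnn in ji.
rewrite barDE /= !linearD linearZ_LR /= first_coord_inj add0r.
rewrite -prependE first_coord_prepend first_coord_prepend.
case: a ia => j a /= ij; rewrite neq0; last by move=> ji; rewrite ji ltnn in ij.
rewrite scaler0 scaler0 addr0.
have -> : first_coord i p (mul_head_word mul (existT _ j a) w x) = 0.
  case: w => [|b w] /=; first exact: linear0.
  rewrite first_coordE /ainf_m2 neq0 ?scaler0 //= => ji.
  by move: ij; rewrite -ji ltnNge addnS ltnW // ltnS leq_addr.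
rewrite addr0; case: j a ij => // j a; rewrite ltnS => ij.
rewrite /letcomp /ainf_m1 /=; have [ji|/eqP ji] := eqVneq j i; last first.
  rewrite !component_neq // => [|[]//]; by rewrite !scaler0 linear0 oppr0.
case: _ / ji; rewrite !(component_id (X := fun i => A i.+1)).
by rewrite linearZ_LR scalerN.
Qed.

Definition last_part : {linear bar -> bar} := bar_proj A G (fun s => s.1 == [::]).

Lemma bar_proj_split (q q1 q2 : pred (seq nat * nat)) z :
  (forall s, q s = q1 s + q2 s :> nat)%N ->
  bar_proj A G q z = bar_proj A G q1 z + bar_proj A G q2 z.
Proof.
move=> qE; apply: (bar_ext (g := bar_proj A G q1 \+ bar_proj A G q2)) => w x /=.
rewrite !bar_projE; have := qE (wshape w x).
by case: (q _); case: (q1 _); case: (q2 _); rewrite ?addr0 ?add0r.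
Qed.

Lemma bar_proj_id (q : pred (seq nat * nat)) z : q =1 predT -> bar_proj A G q z = z.
Proof. by move=> qT; apply: (bar_ext (g := idfun)) => w x; rewrite bar_projE qT. Qed.

Lemma last_first z : z = last_part z + first_tag predT z.
Proof. by rewrite -[LHS](@bar_proj_id predT) //; apply: bar_proj_split => -[[|? ?] ?]. Qed.

Lemma first_tag_lt_ge i z : first_tag predT z =
  first_tag (fun j => (j < i)%N) z + first_tag (fun j => (i <= j)%N) z.
Proof.
apply: bar_proj_split => -[[|j s] k] //=; by case: ltnP.
Qed.

Lemma first_tag_ltS i z : first_tag (fun j => (j < i.+1)%N) z =
  first_tag (fun j => (j < i)%N) z + first_tag (pred1 i) z.
Proof.
apply: bar_proj_split => -[[|j s] k] //=; rewrite ltnS leq_eqVlt.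
by case: (j =P i) => [->|_]; rewrite ?ltnn //= addn0.
Qed.

Lemma first_coord_last i p z : first_coord i p (barD (last_part z)) = 0.
Proof.
apply: (bar_ext (f := first_coord i p \o barD \o last_part) (g := \0)) => w x /=.
rewrite bar_projE; case: w => [|a w] /=; last by rewrite !linear0.
by rewrite bw_nil barD_inj first_coord_inj.
Qed.

(** For i > 0 the differential is read off from D r itself. For i = 0 it is the d_1 absent from D,
    recovered from D (D r). *)
Lemma dif_first_coord i p r : barD r = 0 -> first_tag (fun j => (j < i)%N) r = 0 ->
  dif A i.+1 (first_coord i p r) = 0.
Proof.
move=> Dr lt0; case: i lt0 => [_|i lt0].
  rewrite -[LHS](dg_coordK mul) -coord_bar_curv -(barD2 m) Dr.
  by rewrite [barD _]linear0 [coord _ _]linear0 scale0r.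
apply/eqP; rewrite -oppr_eq0 -first_coord_barD; apply/eqP.
have -> : first_tag (fun j => (i < j)%N) r = r - last_part r.
  by rewrite {2}[r]last_first (first_tag_lt_ge i.+1) lt0 add0r addrC addKr.
by rewrite !linearB Dr /= first_coord_last subr0 linear0.
Qed.

Lemma bar_curv_psus i t (a : A i.+2) : bar_curv (psus i.+1 t a) = 0.
Proof. by rewrite psusE bar_curv_prepend /curv scale0r. Qed.

Lemma first_tag_barD_psus i t (a : A i.+2) :
  first_tag (fun j => (j < i.+1)%N) (barD (psus i.+1 t a)) = psus i t (- dif A i.+2 a).
Proof.
rewrite psusE barDN barN_prepend !linearD linearZ_LR /=.
have -> : first_tag (fun j => (j < i.+1)%N) (barM m (prepend (sus a) t)) = 0.
  apply: (bar_ext (f := first_tag _ \o barM m \o prepend (sus a)) (g := \0)) => w x /=.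
  by rewrite prependE barME /mleft bar_injE first_tag_nil.
have -> : first_tag (fun j => (j < i.+1)%N) (mul_head mul G (sus a) t) = 0.
  apply: (bar_ext (f := first_tag _ \o mul_head mul G (sus a)) (g := \0)) => w x /=.
  rewrite mul_headE; case: w => [|b w] /=; first by rewrite linear0.
  by rewrite first_tag_cons /= ifN // -leqNgt addSn ltnS leq_addr.
by rewrite !first_tag_prepend /= ltnSn ltnn scaler0 !addr0 add0r psusE.
Qed.

(* The coordinates of the leading letters of lowest degree are cycles of A, hence
   boundaries, and a primitive of them is one degree higher. *)
Lemma bar_kill i r : barD r = 0 -> first_tag (fun j => (j < i)%N) r = 0 ->
  exists u : bar, bar_curv u = 0 /\ first_tag (fun j => (j < i.+1)%N) (r - barD u) = 0.
Proof.
move=> Dr lt0; have [s sE] := first_expand i r.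
have /choice [y yE] p : exists y : A i.+2, - dif A i.+2 y = first_coord i p r.
  have [y yE] := res_exact (dif_first_coord p Dr lt0).
  by exists (- y); rewrite linearN opprK.
exists (\sum_(p <- s) psus i.+1 (bbw p) (y p)); split.
  by rewrite linear_sum big1 // => p _; apply: bar_curv_psus.
rewrite linearB [X in X - _]first_tag_ltS lt0 add0r sE [barD _]linear_sum [X in _ - X]linear_sum.
rewrite -sumrB big1 // => p _.
by rewrite first_tag_barD_psus yE subrr.
Qed.

(** Zero curvature of [u] is carried along because it keeps [r - barD u] a cycle, so that the next
    round can start. *)
Lemma bar_kill_all r : barD r = 0 ->
  forall i, exists u : bar, bar_curv u = 0 /\ first_tag (fun j => (j < i)%N) (r - barD u) = 0.
Proof.
move=> Dr; elim=> [|i [u [ku ru]]].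
  exists 0; split; first exact: linear0.
  by apply: (bar_ext (g := \0)) => w x; rewrite bar_projE; case: w.
have Dru : barD (r - barD u) = 0 by rewrite linearB Dr barD2 ku subrr.
have [v [kv rv]] := bar_kill Dru ru; exists (u + v).
by rewrite [bar_curv _]linearD ku kv addr0 [barD _]linearD opprD addrA.
Qed.

Fact retract_multilinear n :
  multilinear (fun w x => if w is [::] then component n x else 0 : G n).
Proof.
split=> [[|a u] v i c a' b x|[|a w] j c x y] /=; rewrite ?scaler0 ?addr0 //.
exact: component_linear.
Qed.
Definition retract n : {linear bar -> G n} := bar_lift (@retract_multilinear n).
Lemma retractE n w x : retract n (bw w x) = if w is [::] then component n x else 0.
Proof. exact: bar_liftE. Qed.

Lemma retract_inj n (x : G n) : retract n (bar_inj n x) = x.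
Proof. by rewrite bar_injE retractE component_id. Qed.

Lemma homog_last n z : homog n (last_part z) = bar_inj n (retract n z).
Proof.
apply: (bar_ext (f := homog n \o last_part) (g := bar_inj n \o retract n)) => w x /=.
rewrite bar_projE retractE; case: w => [|a w] /=; last by rewrite !linear0.
case: x => j x; rewrite homogE /word_deg /=; have [jn|/eqP jn] := eqVneq j n.
  by case: _ / jn; rewrite component_id bar_injE.
by rewrite component_neq // linear0.
Qed.

(** A letter of tag j has degree j + 2, so the degree bounds the leading tag and finitely many
    rounds of [bar_kill] suffice. *)
Lemma homog_first n z :
  homog n (first_tag predT z) = homog n (first_tag (fun j => (j.+1 < n)%N) z).
Proof.
rewrite /homog /first_tag !bar_projI; apply: bar_proj_eq => -[[|j s] k] //=.
by rewrite /word_deg /= andbT; case: eqP => //= <-; rewrite !addSn !ltnS -addnA leq_addr.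
Qed.

Lemma homog_small n z : (n <= 1)%N -> homog n z = bar_inj n (retract n z).
Proof.
move=> n1; rewrite {1}[z]last_first linearD homog_last homog_first.
rewrite (_ : first_tag _ z = 0) ?linear0 ?addr0 //.
apply: (bar_ext (g := \0)) => -[|a w] x; rewrite bar_projE //= ifN // -leqNgt.
exact: leq_trans n1 _.
Qed.

Lemma homog_idem n z : homog n (homog n z) = homog n z.
Proof. by rewrite homog_homog eqxx. Qed.

Lemma retract_homog n z : retract n (homog n z) = retract n z.
Proof.
apply: (bar_ext (f := retract n \o homog n)) => -[|a w] x /=.
  case: x => j x; rewrite homogE /word_deg /=; case: eqP => // jn.
  by rewrite linear0 retractE component_neq.
by rewrite homogE; case: ifP => // _; rewrite linear0 retractE.
Qed.

Definition ker_mult (t : bar) : Prop := exists c (b : bar), pi c = 0 /\ t = c *: b.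

(** Exactness of A at A_0: the kernel of [pi] is the image of d_1. *)
Lemma curv_surj c : pi c = 0 -> exists a : A 1%N, curv mul (sus a) = c.
Proof.
move=> c0; have : aug A (c *: dg_one mul) = 0.
  rewrite linearZ_LR dg_aug1; rewrite /GRing.scale /= /restr_scale c0.
  exact: scale0r.
move=> /res_exact0 [a da]; exists a; rewrite /curv /= da linearZ_LR dg_coord1.
exact: mulr1.
Qed.

Lemma bar_curv_surj z : span ker_mult z -> exists u : bar, bar_curv u = z.
Proof.
move: z; apply: span_ind => [|c _ t [d [b [d0 ->]]] [u ut]]; first by exists 0; rewrite linear0.
have [a ad] := curv_surj d0.
by exists (c *: prepend (sus a) b + u); rewrite linearP bar_curv_prepend ad ut.
Qed.

Lemma homog_bar_curv n z : bar_curv (homog n.+2 z) = homog n (bar_curv z).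
Proof.
apply: (bar_ext (f := bar_curv \o homog n.+2) (g := homog n \o bar_curv)) => w x /=.
rewrite homogE bar_curvE; case: w => [|[[|i] a] w]; rewrite ?linear0 ?if_same //.
- by case: ifP; rewrite ?linear0 // bar_curvE.
- rewrite linearZ_LR homogE word_deg_cons /= !addSn add0n !eqSS.
  by case: ifP; rewrite ?linear0 ?scaler0 // bar_curvE.
- rewrite /curv /= scale0r linear0; case: ifP; rewrite ?linear0 // bar_curvE.
  by rewrite /curv scale0r.
Qed.


Hypothesis G_exact : forall n (x : G n.+1), dif G n.+1 x = 0 -> exists y : G n.+2, dif G n.+2 y = x.

(* As [barD] squares to the curvature, an element of the kernel of Q -> R times
   the bar module is a curvature term, and correcting by it gives a genuine cycle. *)
Lemma bar_exact n z : homog n.+1 z = z -> span ker_mult (barD z) ->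
  exists v : bar, barD v = z.
Proof.
move=> zn /bar_curv_surj [u0 u0E]; pose u := homog n.+2 u0.
have ku : bar_curv u = barD z by rewrite homog_bar_curv u0E homog_barD zn.
have Dr : barD (z - barD u) = 0 by rewrite linearB barD2 ku subrr.
have [v [kv tv]] := bar_kill_all Dr n.
set r := z - barD u in Dr tv; set t := r - barD v in tv.
have Dt : barD t = 0 by rewrite linearB Dr barD2 kv subrr.
(* In degree n + 1 all leading tags are below n and have been killed, so only the component in G
   remains, where exactness of G applies. *)
have tn : homog n.+1 t = bar_inj n.+1 (retract n.+1 t).
  rewrite {1}[t]last_first linearD homog_last homog_first [first_tag _ t]tv.
  by rewrite linear0 addr0.
have /G_exact [y yE] : dif G n.+1 (retract n.+1 t) = 0.
  by rewrite -(retract_inj (dif G n.+1 _)) -[bar_inj _ _](barD_inj m (retract n.+1 t)) -tn -homog_barD Dt !linear0.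
(* The primitive [v] may be inhomogeneous; only its part of degree n + 2 meets [z]. *)
exists (u + homog n.+2 v + bar_inj n.+2 y).
have uu : homog n.+2 u = u by apply: homog_idem.
rewrite linearD [barD (bar_inj _ _)]barD_inj /= yE -tn linearD.
rewrite /t /r !linearB zn !homog_barD uu.
by rewrite -[z - _ - _]addrA -opprD [LHS]addrC; apply: subrK.
Qed.

End BarExact.

(** * Comparison with a free resolution over R *)

(* The target is an acyclic complex with all degrees in one module [L]; [H n] is the
   projection onto degree n. *)
Section Comparison.
Variables (S : comNzRingType) (P : complex S) (L : lmodType S).
Variables (D : {linear L -> L}) (H : nat -> {linear L -> L}).
Hypothesis P_free : forall n, free_module (P n).
Hypothesis HH : forall n z, H n (H n z) = H n z.
Hypothesis HD : forall n z, H n (D z) = D (H n.+1 z).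
Hypothesis L_exact : forall n z, H n.+1 z = z -> D z = 0 -> exists y, D y = z.

Lemma lift_homogeneous n i (f : {linear P i -> L}) :
  (forall x, H n (f x) = f x) -> (forall x, exists y, D y = f x) ->
  exists g : {linear P i -> L}, (forall x, H n.+1 (g x) = g x) /\ forall x, D (g x) = f x.
Proof.
move=> fH fD; have [g gE] := free_lift (P_free i) fD.
by exists (H n.+1 \o g); split=> x /=; rewrite ?HH // -HD gE fH.
Qed.

Lemma lift_chain (f0 : {linear P 0%N -> L}) :
  (forall x, H 0 (f0 x) = f0 x) -> (forall x : P 1%N, exists y, D y = f0 (dif P 1 x)) ->
  exists f : forall i, {linear P i -> L},
    [/\ forall x, f 0%N x = f0 x, forall i x, H i (f i x) = f i x &
        forall i x, D (f i.+1 x) = f i (dif P i.+1 x)].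
Proof.
move=> f0H f0D.
(* Liftability of the next composite is part of the invariant, which makes the dependent recursion
   total. *)
pose good i (f : {linear P i -> L}) := (forall x, H i (f x) = f x) /\
  forall x : P i.+1, exists y, D y = f (dif P i.+1 x).
have step i (f : {f | good i f}) : {g : {g | good i.+1 g} |
    forall x, D (sval g x) = sval f (dif P i.+1 x)}.
  apply: cid; case: f => f [fH fD] /=.
  have [g [gH gD]] := lift_homogeneous (f := f \o dif P i.+1) (fun x => fH _) fD.
  suff gg : good i.+1 g by exists (exist _ g gg).
  split=> // x; apply: L_exact => //.
  by rewrite gD /=; rewrite (difK x : dif P i.+1 (dif P i.+2 x) = 0) linear0.
pose f := nat_rect (fun i => {f | good i f}) (exist _ f0 (conj f0H f0D))
  (fun i f => sval (step i f)).
exists (fun i => sval (f i)); split=> // i x.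
- by have [] := svalP (f i).
- exact: (svalP (step i (f i))).
Qed.

Lemma null_homotopy (f : forall i, {linear P i -> L}) :
  (forall i x, H i (f i x) = f i x) ->
  (forall i x, D (f i.+1 x) = f i (dif P i.+1 x)) ->
  (forall x, exists y, D y = f 0%N x) ->
  exists s : forall i, {linear P i -> L},
    forall i x, D (s i.+1 x) = f i.+1 x - s i (dif P i.+1 x).
Proof.
move=> fH fD f0.
pose good i (s : {linear P i -> L}) := (forall x, H i.+1 (s x) = s x) /\
  forall x : P i.+1, D (f i.+1 x - s (dif P i.+1 x)) = 0.
have step i (s : {s | good i s}) : {t : {t | good i.+1 t} |
    forall x, D (sval t x) = f i.+1 x - sval s (dif P i.+1 x)}.
  apply: cid; case: s => s [sH sD] /=.
  pose h : {linear P i.+1 -> L} := f i.+1 \- (s \o dif P i.+1).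
  have hH x : H i.+1 (h x) = h x by rewrite linearB /= fH sH.
  have hD x : exists y, D y = h x by apply: L_exact; [apply: hH | apply: sD].
  have [g [gH gD]] := lift_homogeneous hH hD.
  suff gg : good i.+1 g by exists (exist _ g gg).
  split=> // x; rewrite linearB fD gD /=.
  by rewrite (difK x : dif P i.+1 (dif P i.+2 x) = 0) linear0 subr0 subrr.
have [s0 [s0H s0D]] := lift_homogeneous (fH 0%N) f0.
have good0 : good 0%N s0 by split=> // x; rewrite linearB fD s0D subrr.
pose s := nat_rect (fun i => {s | good i s}) (exist _ s0 good0) (fun i s => sval (step i s)).
exists (fun i => sval (s i)) => i x.
exact: (svalP (step i (s i))).
Qed.
End Comparison.

(* An S-module killed by the kernel of a surjection theta : S -> T, viewed as a
   T-module. *)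
Section Coextension.
Variables (S T : comNzRingType) (theta : {rmorphism S -> T}).
Variable theta_surj : forall y : T, exists x : S, theta x = y.

Definition annihilated (V : lmodType S) := forall c (v : V), theta c = 0 -> c *: v = 0.

Section Module.
Variables (V : lmodType S) (V_ann : annihilated V).

Definition coext of (forall y : T, exists x : S, theta x = y) & annihilated V : Type := V.
Local Notation W := (coext theta_surj V_ann).

HB.instance Definition _ := GRing.Zmodule.on W.

(** Acts through a chosen preimage; annihilation by the kernel makes the choice irrelevant. *)
Definition coext_scale (r : T) (v : W) : W := projT1 (cid (theta_surj r)) *: (v : V).

Lemma coext_scale_image c v : coext_scale (theta c) v = c *: (v : V).
Proof.
rewrite /coext_scale; case: cid => d /= dc; apply/eqP.
by rewrite -subr_eq0 -scalerBl V_ann // rmorphB dc subrr.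
Qed.

Fact coext_scaleA a b x : coext_scale a (coext_scale b x) = coext_scale (a * b) x.
Proof.
have [c <-] := theta_surj a; have [d <-] := theta_surj b.
by rewrite -rmorphM !coext_scale_image scalerA.
Qed.
Fact coext_scale1 : left_id 1 coext_scale.
Proof. by move=> x; rewrite -(rmorph1 theta) coext_scale_image scale1r. Qed.
Fact coext_scaleDr : right_distributive coext_scale +%R.
Proof. by move=> a x y; apply: scalerDr. Qed.
Fact coext_scaleDl x : {morph coext_scale^~ x : a b / a + b}.
Proof.
move=> a b; have [c <-] := theta_surj a; have [d <-] := theta_surj b.
by rewrite -rmorphD !coext_scale_image scalerDl.
Qed.

HB.instance Definition _ := GRing.Zmodule_isLmodule.Build T W
  coext_scaleA coext_scale1 coext_scaleDr coext_scaleDl.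

Lemma coext_scaleE c (v : V) : theta c *: (v : W) = c *: v.
Proof. exact: coext_scale_image. Qed.
End Module.

Lemma coext_linear (V V' : lmodType S) (V_ann : annihilated V) (V'_ann : annihilated V')
    (f : {linear V -> V'}) :
  linear (f : coext theta_surj V_ann -> coext theta_surj V'_ann).
Proof.
move=> r x y; have [c <-] := theta_surj r.
by rewrite !coext_scaleE linearP.
Qed.

Lemma coext_linear_to (V : lmodType S) (V_ann : annihilated V) (M : lmodType T)
    (f : {linear V -> restr M theta}) :
  linear (f : coext theta_surj V_ann -> M).
Proof.
move=> r x y; have [c <-] := theta_surj r.
by rewrite coext_scaleE linearP.
Qed.

Lemma restr_linear (V : lmodType S) (V_ann : annihilated V) (U : lmodType S) (M : lmodType T)
    (h : {linear U -> restr M theta}) (f : {linear M -> coext theta_surj V_ann}) :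
  linear (fun x => f (h x : M) : V).
Proof.
move=> c x y; rewrite linearP -[c *: _]/(theta c *: (h x : M)).
by rewrite [f _]linearP coext_scaleE.
Qed.
End Coextension.

(** * The bar complex over R as a resolution of M *)

Section BarResolution.
Variables (Q R : comNzRingType) (pi : {rmorphism Q -> R}).
Hypothesis pi_surj : forall y : R, exists x : Q, pi x = y.
Variables (A : free_resolution (restr R^o pi)) (mul : dg_algebra A).
Variables (M : lmodType R) (G : free_resolution (restr M pi)) (m : ainf_module mul G).
Local Notation bar := (bar A G).
Local Notation barD := (barD m).
Local Notation homog := (homog A G).
Local Notation bar_inj := (bar_inj A G).
Local Notation retract := (retract A G).
Implicit Types z : bar.

(* R (x) T(A_+[1]) (x) G, still as a Q-module; [coext] makes it an R-module. *)
Definition rbar : lmodType Q := quotmod (@ker_mult Q R pi A G).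
Definition rbar_pi : {linear bar -> rbar} := quot_pi (@ker_mult Q R pi A G).

Lemma rbar_pi_surj (t : rbar) : exists z, t = rbar_pi z.
Proof. exact: quot_pi_surj. Qed.

Lemma rbar_ann : annihilated pi rbar.
Proof.
move=> c t c0; have [z ->] := rbar_pi_surj t; rewrite -linearZ_LR.
rewrite -[RHS](linear0 rbar_pi); apply/quot_pi_eq; rewrite subr0.
by apply: span_gen; exists c, z.
Qed.

Lemma restr_ann (N : lmodType R) : annihilated pi (restr N pi).
Proof. by move=> c v c0; rewrite /GRing.scale /= /restr_scale c0; exact: (scale0r (v : N)). Qed.

Section Descend.
Variables (V : lmodType Q) (V_ann : annihilated pi V) (f : {linear bar -> V}).
Fact descend_subproof z : ker_mult z -> f z = 0.
Proof. by move=> [c [b [c0 ->]]]; rewrite linearZ_LR V_ann. Qed.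
Definition descend : {linear rbar -> V} := quot_lift descend_subproof.
Lemma descendE z : descend (rbar_pi z) = f z.
Proof. exact: quot_liftE. Qed.
End Descend.

Definition rbarD : {linear rbar -> rbar} := descend rbar_ann (rbar_pi \o barD).
Definition rhomog n : {linear rbar -> rbar} := descend rbar_ann (rbar_pi \o homog n).
Definition raug : {linear rbar -> restr M pi} := descend (@restr_ann M) (aug G \o retract 0).

Lemma rbarDE z : rbarD (rbar_pi z) = rbar_pi (barD z). Proof. exact: descendE. Qed.
Lemma rhomogE n z : rhomog n (rbar_pi z) = rbar_pi (homog n z). Proof. exact: descendE. Qed.
Lemma raugE z : raug (rbar_pi z) = aug G (retract 0 z). Proof. exact: descendE. Qed.

Lemma rhomog_idem n t : rhomog n (rhomog n t) = rhomog n t.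
Proof. by have [z ->] := rbar_pi_surj t; rewrite !rhomogE homog_idem. Qed.

Lemma rhomogD n t : rhomog n (rbarD t) = rbarD (rhomog n.+1 t).
Proof. by have [z ->] := rbar_pi_surj t; rewrite rbarDE !rhomogE homog_barD rbarDE. Qed.

Lemma rbar_exact n t : rhomog n.+1 t = t -> rbarD t = 0 -> exists y, rbarD y = t.
Proof.
have [z ->] := rbar_pi_surj t; rewrite rhomogE => zn Dz.
(* Homogeneity of [z] is known only modulo ker pi, so [z] is replaced by its homogeneous part. *)
have := @bar_exact _ _ _ _ _ _ m (fun i => free_basis (res_free A i.+1))
  (fun i => free_basis (res_free G i)) (@res_exact _ _ G) n (homog n.+1 z).
case=> [||v vE]; first exact: homog_idem.
  have : rbar_pi (barD (homog n.+1 z)) = rbar_pi 0 by rewrite -rbarDE zn Dz linear0.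
  by move=> /quot_pi_eq; rewrite subr0.
by exists (rbar_pi v); rewrite rbarDE vE.
Qed.

Lemma rbar_exact0 t : rhomog 0 t = t -> raug t = 0 -> exists y, rbarD y = t.
Proof.
have [z ->] := rbar_pi_surj t; rewrite raugE rhomogE => zn /res_exact0 [g gE].
exists (rbar_pi (bar_inj 1 g)); rewrite rbarDE [barD _]barD_inj /= gE.
by rewrite -(homog_small (n := 0)).
Qed.

(** Letters have degree at least 2, so in degrees 0 and 1 the bar complex is just G. *)
Lemma raugD t : raug (rbarD t) = 0.
Proof.
have [z ->] := rbar_pi_surj t; rewrite rbarDE raugE -retract_homog homog_barD.
rewrite homog_small // [barD _]barD_inj [retract _ _]retract_inj.
by apply/res_exact0; exists (retract 1 z).
Qed.

Lemma raug_homog t : raug (rhomog 0 t) = raug t.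
Proof. by have [z ->] := rbar_pi_surj t; rewrite rhomogE !raugE retract_homog. Qed.

Variables (F : free_resolution M) (phi : chain_map pi G F).
Hypothesis phi_lift : lifts_id phi.

Local Notation L := (coext pi_surj rbar_ann).

(* [th] lifts the identity of M, and [s] is a homotopy from the inclusion of G to
   the composite of [th] with [phi]. *)
Lemma bar_comparison : exists (th : forall i, {linear F i -> L})
    (s : forall i, {linear G i -> rbar}),
  (forall i y, rbarD (th i.+1 y) = th i (dif F i.+1 y)) /\
  (forall i x, rbarD (s i.+1 x) = th i.+1 (phi i.+1 x) - rbar_pi (bar_inj i.+1 x) - s i (dif G i.+1 x)).
Proof.
pose D : {linear L -> L} := mklin (@coext_linear _ _ _ pi_surj _ _ rbar_ann rbar_ann rbarD).
pose H n : {linear L -> L} := mklin (@coext_linear _ _ _ pi_surj _ _ rbar_ann rbar_ann (rhomog n)).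
pose U : {linear L -> M} := mklin (@coext_linear_to _ _ _ pi_surj _ rbar_ann _ raug).
have DE t : D t = rbarD t by apply: mklinE.
have HE n t : H n t = rhomog n t by apply: mklinE.
have UE t : U t = raug t by apply: mklinE.
have augL y : exists t, U t = aug F y.
  have [g gE] := @aug_surj _ _ G (aug F y).
  exists (rbar_pi (bar_inj 0 g)); rewrite UE raugE; by rewrite [retract _ _]retract_inj.
have [th0 th0U] := free_lift (res_free F 0) augL.
have HH n t : H n (H n t) = H n t by rewrite !HE rhomog_idem.
have HD n t : H n (D t) = D (H n.+1 t) by rewrite !HE !DE rhomogD.
have DU t : U (D t) = 0 by rewrite UE DE raugD.
have HU t : U (H 0%N t) = U t by rewrite !UE HE raug_homog.
have L_exact n t : H n.+1 t = t -> D t = 0 -> exists y, D y = t.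
  by rewrite HE DE => tn Dt; have [y yE] := rbar_exact tn Dt; exists y; rewrite DE.
have L_exact0 t : H 0%N t = t -> U t = 0 -> exists y, D y = t.
  by rewrite HE UE => tn Ut; have [y yE] := rbar_exact0 tn Ut; exists y; rewrite DE.
(* The lift [th0] need not be homogeneous; its degree 0 part has the same augmentation. *)
pose f0 : {linear F 0%N -> L} := H 0%N \o th0.
have f0H x : H 0%N (f0 x) = f0 x by apply: HH.
have f0U x : U (f0 x) = aug F x by rewrite [U _]HU.
have f0D (x : F 1%N) : exists y, D y = f0 (dif F 1 x).
  by apply: L_exact0 => //; rewrite f0U; apply/res_exact0; exists x.
have [th [th0E thH thD]] := lift_chain (res_free F) HH HD L_exact f0H f0D.
pose h i : {linear G i -> rbar} := mklin (restr_linear (phi i) (th i)).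
have hE i x : h i x = th i (phi i x) by apply: mklinE.
pose f i : {linear G i -> rbar} := h i \- (rbar_pi \o bar_inj i).
have fE i x : f i x = th i (phi i x) - rbar_pi (bar_inj i x) by rewrite /= hE.
have fH i x : rhomog i (f i x) = f i x.
  by rewrite fE linearB rhomogE homog_inj -HE thH.
have fD i x : rbarD (f i.+1 x) = f i (dif G i.+1 x).
  by rewrite !fE linearB rbarDE [barD _]barD_inj -DE thD (cmap_dif phi x : phi i (dif G i.+1 x) = _).
(* Both maps lift the identity of M, so their difference has zero augmentation and the null homotopy
   can start. *)
have f0_0 x : exists y, rbarD y = f 0%N x.
  apply: rbar_exact0; first exact: fH.
  rewrite fE linearB -UE th0E f0U raugE [retract _ _]retract_inj.
  by rewrite phi_lift subrr.
have [s sE] := null_homotopy (res_free G) rhomog_idem rhomogD rbar_exact fH fD f0_0.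
exists th, s; split=> i x; first by rewrite -DE thD.
by rewrite sE fE.
Qed.

End BarResolution.

(** * Uniqueness of the product up to homotopy *)

Section Bilinear.
Variables (S : comNzRingType) (V W U : lmodType S).
Implicit Types f g : V -> W -> U.

Lemma bilin0l f y : bilin f -> f 0 y = 0.
Proof. by case=> fl _; rewrite -(mklinE (fl y)) linear0. Qed.

Lemma bilin0r f x : bilin f -> f x 0 = 0.
Proof. by case=> _ fr; rewrite -(mklinE (fr x)) linear0. Qed.

Lemma bilin_cst0 : bilin (fun (_ : V) (_ : W) => 0 : U).
Proof. by split=> ? c ? ?; rewrite scaler0 addr0. Qed.

Lemma bilinP f g c : bilin f -> bilin g -> bilin (fun x y => f x y + c *: g x y).
Proof.
move=> [fl fr] [gl gr]; split=> [y d x x'|x d y y'].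
- by rewrite fl gl !scalerDr !scalerA [c * d]mulrC addrACA.
- by rewrite fr gr !scalerDr !scalerA [c * d]mulrC addrACA.
Qed.

Lemma bilin_compl (V' : lmodType S) (h : {linear V' -> V}) f :
  bilin f -> bilin (fun x y => f (h x) y).
Proof. by move=> [fl fr]; split=> [y c x x'|x]; [rewrite linearP fl | apply: fr]. Qed.

Lemma bilin_compr (W' : lmodType S) (h : {linear W' -> W}) f :
  bilin f -> bilin (fun x y => f x (h y)).
Proof. by move=> [fl fr]; split=> [y|x c y y']; [apply: fl | rewrite linearP fr]. Qed.

End Bilinear.

Section ProductHomotopy.
Variables (S : comNzRingType) (X Y : complex S) (N : lmodType S) (G : free_resolution N).
Hypothesis X_free : forall n, free_module (X n).
Hypothesis Y_free : forall n, free_module (Y n).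

(* [d i j n] is meant for n = i + j: a morphism of complexes X (x) Y -> G. *)
Variable d : forall i j n, X i -> Y j -> G n.
Hypothesis d_bilin : forall i j n, bilin (d (i := i) (j := j) n).
Hypothesis d_dif : forall i j (x : X i) (y : Y j),
  dif G (i + j) (d (i + j) x y) =
  d (i + j).-1 (dif X i x) y + (-1) ^+ i *: d (i + j).-1 x (dif Y j y).
Hypothesis d_aug : forall x y, aug G (d (i := 0%N) (j := 0%N) 0 x y) = 0.

(** The homotopy precomposed with the differential of X (x) Y. *)
Definition hterm n (h : forall i j, X i -> Y j -> G n) i j (x : X i) (y : Y j) : G n :=
  h i.-1 j (dif X i x) y + (-1) ^+ i *: h i j.-1 x (dif Y j y).

Lemma hterm_bilin n (h : forall i j, X i -> Y j -> G n) i j :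
  (forall i j, bilin (h i j)) -> bilin (hterm h (i := i) (j := j)).
Proof.
move=> hb; apply: bilinP; first exact/bilin_compl/hb.
exact/bilin_compr/hb.
Qed.

Lemma homotopy_step n (t : forall i j, X i -> Y j -> G n) :
  (forall i j, bilin (t i j)) ->
  (forall i j x y, (i + j)%N = n -> exists z : G n.+1, dif G n.+1 z = t i j x y) ->
  exists h : forall i j, X i -> Y j -> G n.+1,
    (forall i j, bilin (h i j)) /\
    forall i j x y, (i + j)%N = n -> dif G n.+1 (h i j x y) = t i j x y.
Proof.
move=> tb tE.
have ex i j : exists h : X i -> Y j -> G n.+1, bilin h /\
    ((i + j)%N = n -> forall x y, dif G n.+1 (h x y) = t i j x y).
  have [ij|ij] := eqVneq (i + j)%N n; last first.
    by exists (fun _ _ => 0); split; [apply: bilin_cst0 | move=> /eqP; rewrite (negPf ij)].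
  have [h [hb hE]] := free_lift2 (p := dif G n.+1) (X_free i) (Y_free j) (tb i j)
    (fun x y => tE i j x y ij).
  by exists h.
exists (fun i j => projT1 (cid (ex i j))); split=> i j; case: cid => h [hb hE] //=.
by move=> x y /hE.
Qed.

Lemma homotopy_check n (hm : forall i j, X i -> Y j -> G n) (h : forall i j, X i -> Y j -> G n.+1) :
  (forall i j, bilin (hm i j)) -> (forall i j, bilin (h i j)) ->
  (forall i j x y, (i + j)%N = n ->
     dif G n.+1 (h i j x y) = d n x y - hterm hm x y) ->
  forall i j (x : X i) (y : Y j), (i + j)%N = n.+1 ->
    dif G n.+1 (d n.+1 x y - hterm h x y) = 0.
Proof.
move=> hmb hb hE i j x y ij.
have dl : dif G n.+1 (h i.-1 j (dif X i x) y) =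
    d n (dif X i x) y - (-1) ^+ i.-1 *: hm i.-1 j.-1 (dif X i x) (dif Y j y).
  case: i x ij => [|i] x ij.
    by rewrite dif0 (bilin0l _ (hb _ _)) (bilin0l _ (hmb _ _)) (bilin0l _ (d_bilin _ _ _)) linear0 scaler0 subr0.
  rewrite hE; last by case: ij.
  by rewrite /hterm difK (bilin0l _ (hmb _ _)) add0r.
have dr : dif G n.+1 (h i j.-1 x (dif Y j y)) =
    d n x (dif Y j y) - hm i.-1 j.-1 (dif X i x) (dif Y j y).
  case: j y ij {dl} => [|j] y ij.
    by rewrite dif0 (bilin0r _ (hb _ _)) (bilin0r _ (hmb _ _)) (bilin0r _ (d_bilin _ _ _)) linear0 subr0.
  rewrite hE; last by move: ij; rewrite addnS => -[].
  by rewrite /hterm difK (bilin0r _ (hmb _ _)) scaler0 addr0.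
rewrite linearB /hterm linearD linearZ_LR dl dr.
have -> : dif G n.+1 (d n.+1 x y) = d n (dif X i x) y + (-1) ^+ i *: d n x (dif Y j y).
  by have := d_dif x y; rewrite ij.
(* For i = 0 the truncated exponent does not change the sign, but the mixed terms contain [dif 0]
   and vanish; otherwise they cancel. *)
case: i x ij {dl dr} => [|i] x ij.
  by rewrite dif0 (bilin0l _ (hmb _ _)) (bilin0l _ (d_bilin _ _ _)) !scaler0 !subr0 subrr.
rewrite /= exprS mulN1r !scaleNr scalerBr opprB.
set a := d n _ y; set b := _ *: d n x _; set c := _ *: hm _ _ _ _.
by rewrite addrA [a - b + _]addrA subrK subrr.
Qed.

Lemma product_homotopy n : exists h : forall i j, X i -> Y j -> G n.+1,
  (forall i j, bilin (h i j)) /\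
  forall i j (x : X i) (y : Y j), (i + j)%N = n.+1 ->
    exists z : G n.+2, dif G n.+2 z = d n.+1 x y - hterm h x y.
Proof.
(* Two consecutive components of the homotopy suffice: the equation for [h] mentions only [hm]. *)
suff [h [hm [hmb hb hE]]] : exists (h : forall i j, X i -> Y j -> G n.+1)
    (hm : forall i j, X i -> Y j -> G n),
  [/\ forall i j, bilin (hm i j), forall i j, bilin (h i j) &
      forall i j x y, (i + j)%N = n -> dif G n.+1 (h i j x y) = d n x y - hterm hm x y].
  exists h; split=> // i j x y ij.
  by apply: res_exact; apply: (homotopy_check hmb hb hE).
elim: n => [|n [h [hm [hmb hb hE]]]].
  have [||h [hb hE]] := @homotopy_step 0 (fun i j x y => d 0 x y).
  - by move=> i j; apply: d_bilin.
  - move=> [|i] [|j] x y // _; apply/res_exact0; exact: d_aug.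
  exists h, (fun i j _ _ => 0); split=> // [i j|i j x y ij]; first exact: bilin_cst0.
  by rewrite hE // /hterm scaler0 addr0 subr0.
have [||h' [h'b h'E]] := @homotopy_step n.+1 (fun i j x y => d n.+1 x y - hterm h x y).
- move=> i j; have := bilinP (-1) (d_bilin i j n.+1) (hterm_bilin i j hb).
  by under eq_fun => x do under eq_fun => y do rewrite scaleN1r.
- by move=> i j x y ij; apply: res_exact; apply: (homotopy_check hmb hb hE).
by exists h', h.
Qed.
End ProductHomotopy.

(** * Reduction to the residue field *)

Section Reduction.
Variables (S : comNzRingType) (k : fieldType) (rho : {rmorphism S -> k}).

Lemma red_eq0 (V : lmodType S) (x : V) : red rho V x = 0 <-> span (@max_mult _ _ rho V) x.
Proof.
rewrite -(linear0 (red rho V)); split=> [/quot_pi_eq|xP]; rewrite ?subr0 //.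
by apply/quot_pi_eq; rewrite subr0.
Qed.

Lemma red_linear (V W : lmodType S) (f : {linear V -> W}) x :
  red rho V x = 0 -> red rho W (f x) = 0.
Proof. by move=> x0; rewrite -red_mapE x0 linear0. Qed.

Lemma redZ (V : lmodType S) a (x : redmod rho V) : rho a = 0 -> a *: x = 0.
Proof.
move=> a0; have [y ->] := quot_pi_surj x; rewrite -linearZ_LR.
by apply/red_eq0/span_gen; exists a, y.
Qed.

Lemma red_dif (C : complex S) (n : S -> Prop) (n_rho : forall a, n a -> rho a = 0) :
  minimal n C -> forall i (x : C i), red rho (C i.-1) (dif C i x) = 0.
Proof.
move=> C_min [|i] x; first by rewrite dif0 linear0.
apply/red_eq0; move: (C_min i x); apply: (span_linear (f := idfun)) => _ [a [v [na ->]]].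
by apply: span_gen; exists a, v; split=> //; apply: n_rho.
Qed.
End Reduction.

(** * The map from the bar complex to the indecomposables of Tor *)

Section Indecomposables.
Variables (Q : comNzRingType) (n : Q -> Prop) (k : fieldType).
Variables (R : comNzRingType) (pi : {rmorphism Q -> R}).
Hypothesis pi_surj : forall y : R, exists x : Q, pi x = y.
Variable kappa : {rmorphism R -> k}.
Hypothesis residue : forall x : Q, kappa (pi x) = 0 <-> n x.
Variable M : lmodType R.
Variables (A : free_resolution (restr R^o pi)) (A_min : minimal n A).
Variables (G : free_resolution (restr M pi)) (G_min : minimal n G).
Variable mul : dg_algebra A.
Variable mu : tensor_map A G G.
Hypothesis mu_lift : lifts_action mu.
Variable m : ainf_module mul G.
Local Notation rho := (kappa \o pi : {rmorphism Q -> k}).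

Let n_rho a : n a -> rho a = 0. Proof. by move=> /residue. Qed.

(* m_2 extended to A_0 = Q by the scalar action: a morphism of complexes
   A (x) G -> G lifting R (x) M -> M, like [mu]. *)
Definition unital_m2 i j l : A i -> G j -> G l :=
  match i return A i -> G j -> G l with
  | 0%N => fun a x => component l (last_of (dg_coord mul a *: x))
  | i.+1 => fun a x => m [:: sus a] j l x
  end.

Lemma m_letter_linear j l (x : G j) : letter_linear (fun b => m [:: b] j l x).
Proof. by move=> i c b b'; have := ainf_multilinear m [::] [::] c b b'; apply. Qed.

Lemma unital_m2_bilin i j l : bilin (unital_m2 (i := i) (j := j) l).
Proof.
case: i => [|i]; split=> [x c a b|a c x y] /=.
- by rewrite linearP scalerDl -scalerA component_linear.
- by rewrite scalerDr scalerA mulrC -scalerA component_linear.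
- by have := ainf_multilinear m [::] [::] c a b; apply.
- exact: linearP.
Qed.

(** This is [ainf_rel2]; for i = 1 its right-hand side is the scalar action of d_1(a), the value of
    the extended map on A_0. *)
Lemma unital_m2_dif i j (a : A i) (x : G j) :
  dif G (i + j) (unital_m2 (i + j) a x) =
  unital_m2 (i + j).-1 (dif A i a) x + (-1) ^+ i *: unital_m2 (i + j).-1 a (dif G j x).
Proof.
case: i a => [|[|i]] a.
- rewrite dif0 (bilin0l _ (unital_m2_bilin _ _ _)) add0r scale1r /=.
  by rewrite [component _ _]component_id [component _ _]component_id linearZ_LR.
- have := ainf_rel2 m (sus a) x; rewrite /= ainf_map1 ainf_map1 /d1_tensor /=.
  rewrite (_ : m [:: ainf_m1 _] _ _ _ = 0); last first.
    exact: (letter_linear0 0 (m_letter_linear (0 + j) x)).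
  rewrite add0r expr1 scaleN1r expr2 mulrNN mulr1 scale1r => E.
  by rewrite [component _ _]component_id -E addrK.
- have := ainf_rel2 m (sus a) x; rewrite /= ainf_map1 ainf_map1 /d1_tensor /=.
  rewrite /ainf_m1 /= (letter_linearN (m_letter_linear _ x)) addrA.
  move=> /eqP; rewrite addr_eq0 subr_eq => /eqP E.
  by rewrite [LHS]E exprS mulN1r scaleNr opprK addrC.
Qed.

Lemma unital_m2_aug (a : A 0%N) (x : G 0%N) :
  aug G (unital_m2 0 a x - mu 0%N 0%N 0%N a x) = 0.
Proof.
rewrite linearB /= [component _ _]component_id mu_lift linearZ_LR.
rewrite -{2}(dg_coordK mul a) linearZ_LR dg_aug1.
apply/eqP; rewrite subr_eq0; apply/eqP.
rewrite -[LHS]/(pi (dg_coord mul a) *: (aug G x : M)) -[RHS]/((pi (dg_coord mul a) * 1) *: (aug G x : M)).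
by rewrite mulr1.
Qed.

(** Two lifts of R (x) M -> M are homotopic, and every term of the homotopy formula contains a
    differential of A or G, which minimality sends to zero after reduction. *)
Lemma red_m2_mu i j l (a : A i) (x : G j) : (i + j)%N = l.+1 ->
  red rho (G l.+1) (unital_m2 l.+1 a x) = red rho (G l.+1) (mu i j l.+1 a x).
Proof.
move=> ij.
pose d i j l (a : A i) (x : G j) : G l := unital_m2 l a x - mu i j l a x.
have mu_bilin i' j' l' : bilin (fun (a : A i') (x : G j') => mu i' j' l' a x).
  by split=> *; [apply: tmap_linl | apply: tmap_linr].
have d_bilin i' j' l' : bilin (@d i' j' l').
  have := bilinP (-1) (@unital_m2_bilin i' j' l') (mu_bilin i' j' l').
  by under eq_fun => b do under eq_fun => y do rewrite scaleN1r.
have d_dif i' j' (b : A i') (y : G j') : dif G (i' + j') (d _ _ (i' + j')%N b y) =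
    d _ _ (i' + j').-1 (dif A i' b) y + (-1) ^+ i' *: d _ _ (i' + j').-1 b (dif G j' y).
  by rewrite /d linearB unital_m2_dif tmap_dif scalerBr opprD addrACA.
have [h [hb hE]] := product_homotopy (res_free A) (res_free G) d_bilin d_dif unital_m2_aug l.
have [z zE] := hE i j a x ij.
apply/eqP; rewrite -subr_eq0 -linearB -[_ - _]/(d i j l.+1 a x).
rewrite -(subrK (hterm h a x) (d i j l.+1 a x)) -zE linearD.
rewrite (red_dif n_rho G_min z : red rho (G l.+1) (dif G l.+2 z) = 0) add0r /hterm linearD linearZ_LR /=.
rewrite -(mklinE ((hb i.-1 j).1 x)) (red_linear _ (red_dif n_rho A_min a)) add0r.
rewrite -(mklinE ((hb i j.-1).2 a)) (red_linear _ (red_dif n_rho G_min x)).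
by rewrite scaler0.
Qed.

Section CycleClass.
Variable q : nat.

(** Minimality makes the reduced differentials zero, so a Tor class can be attached linearly to
    every element of G. *)
Fact cycle_red_subproof (C : complex Q) : minimal n C ->
  forall x : C q, cycleb (C := redC rho C) (q := q) (red rho (C q) x).
Proof.
move=> C_min x; apply/eqP; have := red_dif n_rho C_min x; rewrite -red_mapE => <-.
by [].
Qed.

Definition cycle_red (C : complex Q) (C_min : minimal n C) (x : C q) : cycles (redC rho C) q :=
  Cycle (cycle_red_subproof C_min x).

End CycleClass.

Section Class.
Variable q : nat.

Definition indec_class_pre (x : G q) : tor_indec kappa mu q :=
  quot_pi (@tor_decomposable Q R pi k kappa M A G mu q) (hclass (cycle_red G_min x)).

Fact indec_class_linear : linear indec_class_pre.
Proof.
move=> c x y; rewrite /indec_class_pre /hclass.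
have -> : cycle_red G_min (c *: x + y) = c *: cycle_red G_min x + cycle_red G_min y.
  by apply: val_inj; rewrite /= linearP.
by rewrite linearP linearP.
Qed.

Definition indec_class : {linear G q -> tor_indec kappa mu q} := mklin indec_class_linear.
Lemma indec_classE x : indec_class x = indec_class_pre x.
Proof. exact: mklinE. Qed.

Lemma indec_class_red x y : red rho (G q) x = red rho (G q) y -> indec_class x = indec_class y.
Proof.
move=> xy; rewrite !indec_classE /indec_class_pre; congr (quot_pi _ (hclass _)).
exact: val_inj.
Qed.

Lemma indec_ann c (t : tor_indec kappa mu q) : rho c = 0 -> c *: t = 0.
Proof.
move=> c0; have [u ->] := quot_pi_surj t; have [z ->] := quot_pi_surj u.
rewrite -!linearZ_LR; have -> : c *: z = 0 by apply: val_inj; rewrite /= redZ.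
by rewrite !linear0.
Qed.

Lemma indec_mu i j (a : A i.+1) (x : G j) : (i.+1 + j)%N = q ->
  indec_class (mu i.+1 j q a x) = 0.
Proof.
move=> ij; rewrite indec_classE /indec_class_pre.
rewrite -[RHS](linear0 (quot_pi (@tor_decomposable Q R pi k kappa M A G mu q))).
apply/quot_pi_eq; rewrite subr0; apply: span_gen.
exists i.+1, j, (hclass (cycle_red A_min a)), (hclass (cycle_red G_min x)); split=> //.
exists a, x; split.
- by exists (cycle_red A_min a).
- by exists (cycle_red G_min x).
- by exists (cycle_red G_min (mu i.+1 j q a x)).
Qed.

Lemma retract_inj_neq l (y : G l) : l <> q -> retract A G q (bar_inj A G l y) = 0.
Proof. by move=> lq; rewrite bar_injE retractE component_neq. Qed.

Lemma indec_retract_red l (y : G l) : red rho (G l) y = 0 ->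
  indec_class (retract A G q (bar_inj A G l y)) = 0.
Proof.
have [lq|/eqP lq] := eqVneq l q; last by rewrite retract_inj_neq // linear0.
move: y; rewrite lq => y y0; rewrite retract_inj.
by rewrite -(linear0 indec_class); apply: indec_class_red; rewrite y0 linear0.
Qed.

Hypothesis m_red : forall w j l (x : G j), (2 <= size w)%N -> red rho (G l) (m w j l x) = 0.

Lemma retract_cons a w x : retract A G q (bar_word (a :: w) x) = 0.
Proof. exact: retractE. Qed.

(* This is where the vanishing of m_n (x) k for n >= 3 is used: only m_1 and m_2
   can reach G from a longer word, and both vanish in the indecomposables. *)
Lemma indec_barD z : indec_class (retract A G q (barD m z)) = 0.
Proof.
apply: (bar_ext (f := indec_class \o retract A G q \o barD m) (g := \0)) => w x /=.
case: w => [|a w].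
  rewrite bw_nil barD_inj; apply: indec_retract_red; exact: (red_dif n_rho G_min).
rewrite barDE /= !linearD linearZ_LR /=.
have -> z' : retract A G q (prepend G a z') = 0.
  apply: (bar_ext (f := retract A G q \o prepend G a) (g := \0)) => v y /=.
  by rewrite prependE retract_cons.
rewrite retract_cons (_ : retract A G q (mul_head_word mul a w x) = 0); last first.
  by case: w => [|b w] /=; rewrite ?linear0 ?retract_cons.
rewrite scaler0 !linear0 !addr0.
case: w => [|b w]; last exact/indec_retract_red/m_red.
case: a x => i a [j x]; rewrite (@mleftE _ _ _ _ _ _ _ (i.+1 + j)%N); last by rewrite word_deg_cons.
rewrite /=.
have [ij|/eqP ij] := eqVneq (i.+1 + j)%N q; last by rewrite retract_inj_neq ?linear0.
rewrite ij retract_inj -(indec_mu a x ij); apply: indec_class_red.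
by rewrite -ij; apply: (@red_m2_mu i.+1 j (i + j)).
Qed.
End Class.

Lemma ann_red (V W : lmodType Q) (f : {linear V -> W}) :
  (forall c (v : W), rho c = 0 -> c *: v = 0) ->
  forall x, red rho V x = 0 -> f x = 0.
Proof.
move=> W_ann x /red_eq0; move: x; apply: span_ind => [|c _ y [a [v [a0 ->]]] y0].
  exact: linear0.
by rewrite linearP y0 addr0 [f _]linearZ_LR (W_ann a) ?scaler0.
Qed.

Lemma boundary_span (S : comNzRingType) (C : complex S) q (z : cycles C q) :
  span (@is_boundary S C q) z -> is_boundary z.
Proof.
move: z; apply: span_ind => [|c z1 z2 [y1 y1E] [y2 y2E]].
  by exists 0; rewrite linear0.
by exists (c *: y1 + y2); rewrite linearP y1E y2E.
Qed.

Variables (F : free_resolution M) (phi : chain_map pi G F).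
Hypothesis phi_lift : lifts_id phi.
Hypothesis m_red : forall w j l (x : G j), (2 <= size w)%N -> red rho (G l) (m w j l x) = 0.

Lemma tor_change_eq0 q (z : cycles (redC rho G) q) (x : G q) :
  val z = red rho (G q) x -> tor_change kappa phi q (hclass z) = 0 ->
  exists f : F q.+1, red kappa (F q) ((phi q x : F q) - dif F q.+1 f) = 0.
Proof.
move=> zx; rewrite /tor_change hmapE.
rewrite -[0 in RHS](linear0 (quot_pi (@is_boundary _ (redC kappa F) q))).
move=> /quot_pi_eq; rewrite subr0 => /boundary_span [y].
have [f ->] := quot_pi_surj y => fE; exists f.
have phiE : val (Defs.cycle_map (red_cmap kappa phi) z) = red kappa (F q) (phi q x).
  by rewrite /= zx; apply: red_cmapE.
rewrite phiE in fE.
have dfE : dif (redC kappa F) q.+1 (red kappa (F q.+1) f) = red kappa (F q) (dif F q.+1 f).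
  exact: red_mapE.
by rewrite linearB -fE -[quot_pi _ f]/(red kappa _ f) dfE subrr.
Qed.

(** The projection to the indecomposables is applied to the homotopy formula of [bar_comparison]; it
    kills everything but the class of [x]. *)
Lemma indec_class_eq0 q (x : G q.+1) (f : F q.+2) :
  red kappa (F q.+1) ((phi q.+1 x : F q.+1) - dif F q.+2 f) = 0 ->
  indec_class q.+1 x = 0.
Proof.
move=> xf; have [th [s [thD sD]]] := bar_comparison pi_surj m phi_lift.
have V_ann : annihilated pi (tor_indec kappa mu q.+1).
  by move=> c v c0; apply: indec_ann; rewrite /= c0 rmorph0.
have [X XE] : exists X : {linear rbar A G -> tor_indec kappa mu q.+1},
    forall z, X (rbar_pi A G z) = indec_class q.+1 (retract A G q.+1 z).
  exists (descend V_ann (indec_class q.+1 \o retract A G q.+1)) => z.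
  exact: descendE.
have XD t : X (rbarD m t) = 0.
  by have [z ->] := rbar_pi_surj t; rewrite rbarDE XE indec_barD.
have := congr1 X (sD q x); rewrite XD !linearB XE retract_inj /=.
(* The homotopy term vanishes: [dif G] is zero after reduction and the target is killed by the
   maximal ideal. *)
rewrite [X (s q _)](ann_red (X \o s q) (@indec_ann q.+1) (red_dif n_rho G_min x)) subr0.
(* Modulo ker kappa times F, [phi x] is a boundary; [th] carries boundaries into the image of
   [rbarD], which [X] kills. *)
have -> : X (th q.+1 (phi q.+1 x)) = 0; last by rewrite sub0r => /esym/eqP; rewrite oppr_eq0 => /eqP.
rewrite -(subrK (dif F q.+2 f) (phi q.+1 x : F q.+1)) linearD linearD -thD XD addr0.
move/red_eq0: xf; move: (_ - _); apply: span_ind => [|r _ y [a [v [a0 ->]]] y0].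
  by rewrite !linear0.
(* [X] is only Q-linear, so the coefficients in R are lifted to Q, where the lift of the one in ker
   kappa annihilates the indecomposables. *)
have [c <-] := pi_surj r; have [b ab] := pi_surj a; rewrite -ab in a0 *.
have thZ d w : X (th q.+1 (pi d *: w)) = d *: X (th q.+1 w).
  by rewrite [th _ _]linearZ_LR coext_scaleE linearZ_LR.
by rewrite linearD linearD y0 addr0 !thZ (@indec_ann _ b) ?scaler0.
Qed.
End Indecomposables.

Theorem corollary3
  (* (Q, n, k) local Noetherian, R = Q / ker pi, with residue map kappa : R ->> k *)
  (Q : comNzRingType) (n : Q -> Prop) (k : fieldType)
  (Q_noeth : noetherian Q) (Q_local : local_ring n)
  (R : comNzRingType) (pi : {rmorphism Q -> R})
  (pi_surj : forall y : R, exists x : Q, pi x = y)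
  (kappa : {rmorphism R -> k})
  (kappa_surj : forall y : k, exists x : R, kappa x = y)
  (residue : forall x : Q, kappa (pi x) = 0 <-> n x)
  (M : lmodType R) (M_fg : fin_gen M)
  (* minimal Q-free resolutions of R and M *)
  (A : free_resolution (restr R^o pi)) (A_min : minimal n A)
  (G : free_resolution (restr M pi)) (G_min : minimal n G)
  (mul : dg_algebra A)
  (* data computing the obstruction: an R-free resolution of M, a chain map
     G -> F over the identity of M, a chain map A (x) G -> G over R (x) M -> M *)
  (F : free_resolution M)
  (phi : chain_map pi G F) (phi_lift : lifts_id phi)
  (mu : tensor_map A G G) (mu_lift : lifts_action mu)
  (o_neq0 : obstruction_nonzero kappa mu phi)
  (m : ainf_module mul G) :
  exists N : nat,
    (3 <= N)%N /\ ainf_contains_unit (kappa \o pi : {rmorphism Q -> k}) m N.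
Proof.
apply: contrapT => no_unit.
have m_red w j l (x : G j) : (2 <= size w)%N ->
    red (kappa \o pi : {rmorphism Q -> k}) (G l) (m w j l x) = 0.
  move=> w2; apply: contrapT => m_neq0; apply: no_unit.
  by exists (size w).+1; split=> //; exists w, j, l, x.
(* Only q >= 1 occurs, as needed for the homotopy formula, which has a term in degree q - 1. *)
have [[|q] [c [// _ [t [cE t0]] c_neq0]]] := o_neq0.
apply: c_neq0; rewrite cE; have [z tE] := quot_pi_surj t; rewrite tE in t0 *.
have [x zx] := quot_pi_surj (val z).
have [f xf] := tor_change_eq0 zx t0.
rewrite -(indec_class_eq0 pi_surj residue A_min G_min mu_lift phi_lift m_red xf).
rewrite indec_classE /indec_class_pre; congr (quot_pi _ (quot_pi _ _)).
exact: val_inj.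
Qed.
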